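(* Let $(G_n)_{n\in\mathbb{N}}$ be a sequence of functions from $\boldsymbol{V}$ with $$\varlimsup_{n\to\infty}\|G_n\|=B<\infty,$$ and let $g_n(t)=\int_{\mathbb{R}} e^{itx}\,dG_n(x)$, $t\in\mathbb{R}$, $n\in\mathbb{N}$. Suppose that $g_n(t)\to g(t)$, $n\to\infty$, for almost all $t\in\mathbb{R}$ (Lebesgue measure), with some function $g:\mathbb{R}\to\mathbb{C}$. Then there exists a function $G\in\boldsymbol{V}$ such that $\|G\|\leqslant B$ and the equality $$g(t)=\int_{\mathbb{R}} e^{itx}\,dG(x)$$ holds for almost all $t\in\mathbb{R}$, including all continuity points $t$ of the function $g$. The function $G$ is uniquely determined in the class $\boldsymbol{V}$, and $(G_n)_{n\in\mathbb{N}}$ converges basically to $G$ ($G_n\Rightarrow G$, $n\to\infty$). If also $g_n(0)\to g(0)$, $n\to\infty$, and $g$ is continuous at $t=0$, then additionally $G_n(+\infty)\to G(+\infty)$, $n\to\infty$.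
   Context: $\boldsymbol{V}$ denotes the class of all functions $G:\mathbb{R}\to\mathbb{R}$ of bounded variation on $\mathbb{R}$ that are right-continuous at every point and satisfy $G(-\infty)=0$, where $G(\pm\infty)$ denote the limits at $\pm\infty$. For $G\in\boldsymbol{V}$, $\|G\|$ is the total variation of $G$ on $\mathbb{R}$. Integrals $\int_{\mathbb{R}} h\,dG$ are Lebesgue--Stieltjes integrals, i.e. integrals with respect to the finite signed measure $\mu_G$ with $\mu_G((a,b])=G(b)-G(a)$. Basic convergence: for $G_n,G\in\boldsymbol{V}$, $(G_n)_{n\in\mathbb{N}}$ converges basically to $G$, written $G_n\Rightarrow G$, $n\to\infty$, if every subsequence of $(G_n)_{n\in\mathbb{N}}$ contains a further subsequence $(G_{n_k})_{k\in\mathbb{N}}$ for which there is an at most countable set $D\subset\mathbb{R}$ (depending in general on the choice of the subsequences) such that $G_{n_k}(x_2)-G_{n_k}(x_1)\to G(x_2)-G(x_1)$, $k\to\infty$, for all $x_1,x_2\in\mathbb{R}\setminus D$. *)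

(* Defs.v *)
From HB Require Import structures.
From mathcomp Require Import all_boot all_order all_algebra.
From mathcomp Require Import complex.
From mathcomp Require Import ring.
From mathcomp Require Import all_classical all_reals all_analysis.

Set Implicit Arguments.
Unset Strict Implicit.
Unset Printing Implicit Defensive.

Import Order.TTheory GRing.Theory Num.Theory.
Import numFieldNormedType.Exports.

Local Open Scope classical_set_scope.
Local Open Scope ring_scope.

(* R[i] carries no topology in the libraries; give it the one induced by its
   modulus, which is already attached to the regular module R[i]^o. *)
HB.instance Definition _ (R : rcfType) := NormedModule.copy R[i] (R[i]^o).

Section bounded_variation_on_the_line.
Context {R : realType}.
Implicit Types G : R -> R.

Definition total_variationR G : \bar R :=
  ereal_sup [set total_variation ab.1 ab.2 G | ab in [set ab | ab.1 <= ab.2]].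

Definition class_V : set (R -> R) :=
  [set G | [/\ (total_variationR G < +oo)%E, right_continuous G &
               G x @[x --> -oo] --> (0 : R)]].

Definition lim_pinfty G : R := lim (G x @[x --> +oo]).

Definition basic_cvg (G_ : nat -> R -> R) G : Prop :=
  forall phi : nat -> nat, {homo phi : m n / (m < n)%N} ->
  exists psi : nat -> nat, {homo psi : m n / (m < n)%N} /\
  exists D : set R, countable D /\
  forall x1 x2 : R, ~ D x1 -> ~ D x2 ->
    G_ (phi (psi k)) x2 - G_ (phi (psi k)) x1 @[k --> \oo] --> G x2 - G x1.

End bounded_variation_on_the_line.

Section charge_integral.
Context d (T : measurableType d) (R : realType).
Variable nu : {charge set T -> \bar R}.

Definition hahn_pos : set T := sval (cid (Hahn_decomposition nu)).

Definition hahn_neg : set T := sval (cid (svalP (cid (Hahn_decomposition nu)))).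

Lemma hahn_pos_neg : hahn_decomposition nu hahn_pos hahn_neg.
Proof. exact: svalP (cid (svalP (cid (Hahn_decomposition nu)))). Qed.

(* By uniqueness of the Jordan decomposition, this does not depend on the
   Hahn decomposition chosen above. *)
Definition charge_integral (f : T -> R) : R :=
  \int[jordan_pos hahn_pos_neg]_x f x - \int[jordan_neg hahn_pos_neg]_x f x.

End charge_integral.

Section lebesgue_stieltjes_charge.
Context {R : realType}.
Implicit Types (G : R -> R) (nu : {charge set (measurableTypeR R) -> \bar R}).

Definition is_ls_charge G nu : Prop :=
  forall a b : R, a <= b -> nu `]a, b]%classic = (G b - G a)%:E.

Lemma ls_measure_itv_oc (f : cumulative R R) (a b : R) : a <= b ->
  lebesgue_stieltjes_measure f `]a, b]%classic = (f b - f a)%:E.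
Proof.
move=> ab; rewrite /lebesgue_stieltjes_measure /measure_extension.
by rewrite measurable_mu_extE/=; [rewrite wlength_itv_bnd|exact: is_ocitv].
Qed.

Lemma ls_measure_finite (f : cumulative R R) (M : R) :
  (forall a b, a <= b -> f b - f a <= M) ->
  fin_num_fun (lebesgue_stieltjes_measure f).
Proof.
move=> fM; apply: lty_fin_num_fun.
apply: (@le_lt_trans _ _ M%:E); last exact: ltry.
pose I n : set R := `]- (n%:R), n%:R]%classic.
rewrite -(bigcup_itvT false false).
have : (lebesgue_stieltjes_measure f \o I) n @[n --> \oo] -->
       lebesgue_stieltjes_measure f (\bigcup_n I n).
  apply: nondecreasing_cvg_mu; rewrite /I//; first exact: bigcup_measurable.
  by move=> *; apply/subsetPset/subset_itv; rewrite leBSide/= ?lerN2 ler_nat.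
move=> cvI; rewrite -[leLHS]/(lebesgue_stieltjes_measure f (\bigcup_n I n)).
rewrite -(cvg_lim _ cvI)//; apply: lime_le.
  by apply/cvg_ex; eexists; exact: cvI.
near=> n; rewrite /= /I ls_measure_itv_oc ?lee_fin ?ge0_cp//.
by apply: fM; rewrite ge0_cp.
Unshelve. all: by end_near. Qed.

Section existence.
Variable G : R -> R.
Hypotheses (GV : (total_variationR G < +oo)%E) (Grc : right_continuous G).

Let TVle a b : a <= b -> (total_variation a b G <= total_variationR G)%E.
Proof. by move=> ab; apply: ereal_sup_ubound; exists (a, b). Qed.

Let TVfin a b : a <= b -> total_variation a b G \is a fin_num.
Proof.
move=> ab; rewrite ge0_fin_numE; last exact: total_variation_ge0.
exact: le_lt_trans (TVle ab) GV.
Qed.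

Let TVRfin : total_variationR G \is a fin_num.
Proof.
rewrite ge0_fin_numE//; apply: le_trans (TVle (lexx 0)).
exact: total_variation_ge0.
Qed.

Let tv a b := fine (total_variation a b G).

Let tvD a b c : a <= c -> c <= b -> tv a b = tv a c + tv c b.
Proof.
move=> ac cb; rewrite /tv (total_variationD G ac cb) fineD//; exact: TVfin.
Qed.

Let tv_ge a b : a <= b -> `|G b - G a| <= tv a b.
Proof.
by move=> ab; rewrite -lee_fin fineK ?TVfin//; exact: total_variation_ge.
Qed.

Let F x := if 0 <= x then tv 0 x else - tv x 0.

Let FB x y : x <= y -> F y - F x = tv x y.
Proof.
move=> xy; rewrite /F; have [x0|x0] := leP 0 x.
  by rewrite (le_trans x0 xy) (@tvD 0 y x)// addrAC subrr add0r.
have [y0|y0] := leP 0 y; rewrite opprK.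
  by rewrite (@tvD x y 0)// ?ltW// addrC.
by rewrite (@tvD x 0 y)// ?ltW// addrC addrK.
Qed.

Let Fnd : nondecreasing F.
Proof.
move=> x y xy; rewrite -subr_ge0 FB//; exact: le_trans (tv_ge xy).
Qed.

Let Frc : right_continuous F.
Proof.
move=> x.
have H : tv x t @[t --> x^'+] --> tv x x.
  have xx1 : x < x + 1 by rewrite ltrDl.
  apply: (@total_variation_right_continuous R x (x + 1) x G) => //.
  by apply/bounded_variationP; [exact: ltW|apply: TVfin; exact: ltW].
have -> : F x = F x + tv x x by rewrite /tv total_variationxx addr0.
apply: cvg_trans (cvgD (cvg_cst (F x)) H).
apply: near_eq_cvg; near=> t => /=.
have xt : x <= t by [].
by transitivity (F x + tv x t) => //; rewrite -(FB xt) addrC subrK.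
Unshelve. all: by end_near. Qed.

Let cF : cumulative R R := HB.pack F (isCumulative.Build R _ R F Fnd Frc).

Let N := F \- G.

Let Nnd : nondecreasing N.
Proof.
move=> x y xy; rewrite -subr_ge0.
have -> : N y - N x = (F y - F x) - (G y - G x) by rewrite /N/=; ring.
rewrite FB// subr_ge0; apply: le_trans (tv_ge xy); exact: ler_norm.
Qed.

Let Nrc : right_continuous N.
Proof. by move=> x; apply: cvgB; [exact: Frc|exact: Grc]. Qed.

Let cN : cumulative R R := HB.pack N (isCumulative.Build R _ R N Nnd Nrc).

Lemma ls_charge_exists_subproof : exists nu, is_ls_charge G nu.
Proof.
have bnd a b : a <= b -> tv a b <= fine (total_variationR G).
  by move=> ab; rewrite fine_le// ?TVfin// TVle.
have finF : fin_num_fun (lebesgue_stieltjes_measure cF).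
  apply: (@ls_measure_finite _ (fine (total_variationR G))) => a b ab.
  by rewrite FB// bnd.
have finN : fin_num_fun (lebesgue_stieltjes_measure cN).
  apply: (@ls_measure_finite _ (fine (total_variationR G) *+ 2)) => a b ab.
  have -> : cN b - cN a = (F b - F a) - (G b - G a) by rewrite /=/N/=; ring.
  rewrite FB// mulr2n lerD ?bnd// (le_trans _ (bnd _ _ ab))//.
  by rewrite (le_trans _ (tv_ge ab))// -normrN ler_norm.
pose muF := HB.pack_for {finite_measure set (measurableTypeR R) -> \bar R}
  (lebesgue_stieltjes_measure cF) (Measure_isFinite.Build _ _ _ _ finF).
pose muN := HB.pack_for {finite_measure set (measurableTypeR R) -> \bar R}
  (lebesgue_stieltjes_measure cN) (Measure_isFinite.Build _ _ _ _ finN).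
exists (cadd (charge_of_finite_measure muF)
             (cscale (-1) (charge_of_finite_measure muN))) => a b ab.
transitivity (lebesgue_stieltjes_measure cF `]a, b]%classic -
              lebesgue_stieltjes_measure cN `]a, b]%classic)%E.
  by rewrite -mulN1e.
rewrite !ls_measure_itv_oc// -EFinB; congr EFin.
by rewrite /=/N/=; ring.
Qed.

End existence.

Lemma ls_charge_exists G : class_V G -> exists nu, is_ls_charge G nu.
Proof. by case=> GV Grc _; exact: ls_charge_exists_subproof. Qed.

(* The finite signed measure with distribution function G: its values on the
   half-open intervals, a pi-system generating the Borel sets, determine it.
   The zero charge is a junk value, never used for G in class_V. *)
Definition ls_charge G : {charge set (measurableTypeR R) -> \bar R} :=
  match pselect (exists nu, is_ls_charge G nu) with
  | left nuG => sval (cid nuG)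
  | right _ => czero
  end.

Lemma ls_chargeP G : class_V G -> is_ls_charge G (ls_charge G).
Proof.
move=> /ls_charge_exists nuG; rewrite /ls_charge.
by case: pselect => // nuG'; exact: svalP (cid nuG').
Qed.

Definition fourier_stieltjes G (t : R) : R[i] :=
  (charge_integral (ls_charge G) (fun x => cos (t * x)) +i*
   charge_integral (ls_charge G) (fun x => sin (t * x)))%C.

End lebesgue_stieltjes_charge.

(* Main.v *)
Require Import Defs.
From HB Require Import structures.
From mathcomp Require Import all_boot all_order all_algebra.
From mathcomp Require Import complex.
From mathcomp Require Import ring lra.
From mathcomp Require Import all_classical all_reals all_analysis.
From mathcomp Require Import measurable_realfun.

(** Write f_G = C + i S for the Fourier-Stieltjes transform of G. Let tau be a
    tent, the triangular bump supported by [s - d, s + d], and let tentF be its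
    cosine transform; it is even, continuous and O(1/u^2), hence integrable.
    Exchanging the integrals in t and y with the one against dG, and translating
    the variable, gives for every G in V the identity integral_tent_avg_fourier:

      int_a^b (int tau(t) Re(e^(-ity) f_G(t)) dt) dy
        = int tentF(u) (G(b - u) - G(a - u)) du.

    The left-hand side only involves the transform, the right-hand side only the
    increments of G, and both are continuous for bounded almost everywhere
    convergence. This identity carries the whole proof.

    Existence. Since the total variations are bounded, Helly's selection
    principle (helly_class_V) extracts from any subsequence a further one whose
    increments converge, off a countable set, to those of a right-continuous
    function G that vanishes at -oo, and the total variation is lower
    semicontinuous for this convergence (total_variationR_limit), so G is in V
    and has variation at most B. Passing to the limit on both sides of the
    identity shows that g and f_G have the same averages against all tents and
    all phases e^(-ity): first integrated over y, then for each y, as these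
    averages are continuous in y. When the tent shrinks to a point, Lebesgue's
    differentiation theorem (ae_eq0_tent) yields g = f_G almost everywhere
    (transform_limit_ae).

    Uniqueness and basic convergence. For the tent of half-width d centred at 0,
    tentF is the Fejer kernel d K(d u) with K nonnegative and of positive
    integral. If f_G = f_H, the identity gives 0 = int d K(d u) w(u) du, where
    w(u) is the increment of G - H over ]a - u, b - u]; letting d tend to
    infinity shows that G - H takes the same value at a and b whenever these are
    continuity points, hence vanishes (class_V_unique). The limit found above is
    thus the same for all subsequences, which is basic convergence.

    Finally f_G is continuous, so that g = f_G also holds at the continuity
    points of g (ae_eq_at_continuity), and f_G(0) is the total mass of dG, that
    is, G(+oo) (cvg_pinfty_cosT0), which settles the last assertion.

    The signed measure dG only enters through class_V_jordan: its Jordan parts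
    are finite measures of mass controlled by the total variation of G, and the
    difference of their values on ]a, b] is G(b) - G(a). *)

Set Implicit Arguments.
Unset Strict Implicit.
Unset Printing Implicit Defensive.

Import Order.TTheory GRing.Theory Num.Theory.
Import numFieldNormedType.Exports.

Local Open Scope classical_set_scope.
Local Open Scope ring_scope.

(** * Integration tools *)

Section integration_tools.

Lemma Rintegral_dominated_cvg d (T : measurableType d) (R : realType)
    (mu : {measure set T -> \bar R}) (D : set T) (f_ : (T -> R)^nat)
    (f g : T -> R) :
  measurable D -> (forall n, measurable_fun D (f_ n)) -> measurable_fun D f ->
  {ae mu, forall x, D x -> f_ ^~ x @ \oo --> f x} ->
  mu.-integrable D (EFin \o g) ->
  (forall n x, D x -> `|f_ n x| <= g x) ->
  \int[mu]_(x in D) f_ n x @[n --> \oo] --> \int[mu]_(x in D) f x.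
Proof.
move=> mD mf_ mf f_f ig f_g.
have mEf_ n : measurable_fun D (fun x => (f_ n x)%:E) by exact/measurable_EFinP.
have mEf : measurable_fun D (fun x => (f x)%:E) by exact/measurable_EFinP.
have cvf : {ae mu, forall x, D x -> (f_ n x)%:E @[n --> \oo] --> (f x)%:E}.
  by apply: filterS f_f => x fx Dx; apply: cvg_EFin; [exact: nearW|exact: fx].
have bndf : {ae mu, forall x n, D x -> (`|(f_ n x)%:E| <= (g x)%:E)%E}.
  by apply: aeW => x n Dx; rewrite lee_fin; exact: f_g.
have [intf _ cv] := dominated_convergence mD mEf_ mEf cvf ig bndf.
by apply: fine_cvg; rewrite fineK//; exact: integrable_fin_num.
Qed.

(** Domination by a product of integrable functions is what all uses below
    provide; it makes every integral in the statement finite. *)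
Lemma Rintegral_Fubini d1 d2 (T1 : measurableType d1) (T2 : measurableType d2)
    (R : realType) (m1 : {sigma_finite_measure set T1 -> \bar R})
    (m2 : {sigma_finite_measure set T2 -> \bar R})
    (f : T1 * T2 -> R) (a : T1 -> R) (b : T2 -> R) :
  measurable_fun setT f -> m1.-integrable setT (EFin \o a) ->
  m2.-integrable setT (EFin \o b) -> (forall x y, `|f (x, y)| <= a x * b y) ->
  \int[m1]_x \int[m2]_y f (x, y) = \int[m2]_y \int[m1]_x f (x, y).
Proof.
move=> mf ia ib fab.
have mf1 x : measurable_fun setT (fun y => f (x, y)).
  exact/measurableT_comp.
have mf2 y : measurable_fun setT (fun x => f (x, y)).
  exact/measurableT_comp.
have i1 x : m2.-integrable setT (fun y => (f (x, y))%:E).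
  apply: (le_integrable measurableT (g := fun y => (a x)%:E * (b y)%:E)%E).
  - exact/measurable_EFinP.
  - move=> y _; rewrite /= lee_fin (le_trans (fab x y))//.
    by rewrite ler_norm.
  - exact: integrableZl.
have i2 y : m1.-integrable setT (fun x => (f (x, y))%:E).
  apply: (le_integrable measurableT (g := fun x => (b y)%:E * (a x)%:E)%E).
  - exact/measurable_EFinP.
  - move=> x _; rewrite /= lee_fin (le_trans (fab x y))//.
    by rewrite mulrC ler_norm.
  - exact: integrableZl.
have i12 : (m1 \x m2)%E.-integrable setT (EFin \o f).
  apply/integrable12ltyP; first exact/measurable_EFinP.
  have ian := integrable_norm ia; have ibn := integrable_norm ib.
  apply: (@le_lt_trans _ _
      (\int[m1]_x (`|a x|%:E * \int[m2]_y `|b y|%:E))%E); last first.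
    rewrite ge0_integralZr//.
    - move/integrableP : ia => [_ iaoo]; move/integrableP : ib => [_ iboo].
      by rewrite lte_mul_pinfty//; [exact: integral_ge0|
        rewrite ge0_fin_numE//; exact: integral_ge0].
    - by move/integrableP: ian => [].
    - by apply: integral_ge0.
  have meas_f : measurable_fun setT (fun z : T1 * T2 => `|(f z)%:E|%E).
    by apply: measurableT_comp => //; exact/measurable_EFinP.
  apply: ge0_le_integral => //.
  - by move=> x _; apply: integral_ge0.
  - exact: (measurable_fun_fubini_tonelli_F (fun z : T1 * T2 => `|(f z)%:E|%E)).
  - by apply: emeasurable_funM => //; case/integrableP: ian.
  - move=> x _; rewrite -ge0_integralZl//.
    + apply: ge0_le_integral => //.
      * exact: (measurableT_comp meas_f).
      * apply: measurable_funeM; by case/integrableP: ibn.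
      * move=> y _; rewrite -EFinM lee_fin (le_trans (fab x y))// -normrM.
        exact: ler_norm.
    + by case/integrableP: ibn.
rewrite /Rintegral.
transitivity (fine (\int[m1]_x \int[m2]_y (f (x, y))%:E)).
  congr fine; apply: eq_integral => x _; rewrite fineK//.
  exact: integrable_fin_num.
rewrite (Fubini i12)/=; congr fine; apply: eq_integral => y _.
by rewrite fineK//; exact: integrable_fin_num.
Qed.

End integration_tools.

Section affine_change_of_variable.
Context {R : realType}.
Local Notation leb := (@lebesgue_measure R).

(** The measure A |-> a * leb {x | a x + c \in A} agrees with Lebesgue measure on
    the intervals ]x, y], hence everywhere. *)
Lemma ge0_integral_affine (a c : R) (f : R -> \bar R) : 0 < a ->
  measurable_fun setT f -> (forall x, (0 <= f x)%E) ->
  (\int[leb]_x f x = a%:E * \int[leb]_x f (a * x + c)%R)%E.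
Proof.
move=> a0 mf f0; pose phi (x : R) : R := a * x + c.
have mphi : measurable_fun [set: measurableTypeR R] (phi : _ -> measurableTypeR R).
  by apply: measurable_funD => //; apply: measurable_funM.
pose phi_mix := isMeasurableFun.Build _ _ _ _ _ mphi.
pose phi_m : {mfun measurableTypeR R >-> measurableTypeR R} := HB.pack phi phi_mix.
pose k : {nonneg R} := NngNum (ltW a0).
rewrite (eq_measure_integral (mscale k (pushforward leb phi_m))); last first.
  move=> A mA _; apply: lebesgue_measure_unique => // _ [[x y] _ <-] /=.
  rewrite /mscale /= /pushforward.
  have -> : phi @^-1` `]x, y]%classic = `](x - c) / a, (y - c) / a]%classic.
    apply/seteqP; split => z /=; rewrite !in_itv /= /phi.
      by rewrite ltr_pdivrMr// ler_pdivlMr// mulrC ltrBlDr lerBrDr.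
    by rewrite ltr_pdivrMr// ler_pdivlMr// mulrC ltrBlDr lerBrDr.
  rewrite !lebesgue_measure_itv /= !lte_fin ltr_pM2r ?invr_gt0// ltrD2r.
  case: ifPn => _; last by rewrite mule0.
  rewrite -EFinB -EFinM; congr EFin.
  by field; rewrite gt_eqF.
rewrite ge0_integral_mscale//=; congr (_ * _)%E.
by rewrite ge0_integral_pushforward.
Qed.

Lemma Rintegral_affine (a c : R) (f : R -> R) : 0 < a ->
  leb.-integrable setT (EFin \o f) ->
  \int[leb]_x f x = a * \int[leb]_x f (a * x + c).
Proof.
move=> a0 intf; have mf := measurable_int _ intf.
have mfa : measurable_fun [set: R] (fun x => (EFin \o f) (a * x + c)).
  apply: (measurableT_comp mf) => //.
  by apply: measurable_funD => //; apply: measurable_funM.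
have intfa : leb.-integrable setT (fun x => (EFin \o f) (a * x + c)).
  apply/integrableP; split=> //; case/integrableP : intf => _.
  rewrite (ge0_integral_affine c a0)//; last exact: measurableT_comp.
  have : (0 <= \int[leb]_x `|(EFin \o f) (a * x + c)%R|)%E by exact: integral_ge0.
  case: (\int[leb]_x `|(EFin \o f) (a * x + c)%R|)%E => [r _ _|_|//].
    exact: ltry.
  by rewrite gt0_muley ?lte_fin// ltxx.
rewrite /Rintegral -[X in X * _]/(fine a%:E) -fineM//; last first.
  exact: integrable_fin_num.
pose fa : R -> \bar R := fun x => (f (a * x + c))%:E.
have Ep : (\int[leb]_x (EFin \o f)^\+ x = a%:E * \int[leb]_x fa^\+ x)%E.
  rewrite (ge0_integral_affine c a0)//; last exact: measurable_funepos.
  by rewrite !unlock.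
have En : (\int[leb]_x (EFin \o f)^\- x = a%:E * \int[leb]_x fa^\- x)%E.
  rewrite (ge0_integral_affine c a0)//; last exact: measurable_funeneg.
  by rewrite !unlock.
congr fine; rewrite (integralE leb setT (EFin \o f)) Ep En.
rewrite -[RHS]/(a%:E * \int[leb]_x fa x)%E (integralE leb setT fa).
apply/esym/muleBr => //; exact: (integrable_add_def measurableT intfa).
Qed.
End affine_change_of_variable.

Section parametric.
Context {R : realType}.

Lemma continuous_Rintegral_dominated d (T : measurableType d)
    (mu : {measure set T -> \bar R}) (f : R -> T -> R) (g : T -> R) :
  (forall y, measurable_fun setT (f y)) -> (forall t, continuous (f ^~ t)) ->
  mu.-integrable setT (EFin \o g) -> (forall y t, `|f y t| <= g t) ->
  continuous (fun y => \int[mu]_t f y t).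
Proof.
move=> mf cf ig fg y; apply/(@cvg_nbhsP _ R^o) => u uy.
apply: (Rintegral_dominated_cvg (g := g)) => //.
by apply: aeW => t _; exact: (cvg_comp _ _ uy (cf t y)).
Qed.

Variable mu : {measure set (measurableTypeR R) -> \bar R}.
Variable phi : R -> R.
Hypothesis iphi : mu.-integrable setT (EFin \o phi).

Let mphi : measurable_fun setT phi.
Proof. by apply/measurable_EFinP; case/integrableP : iphi. Qed.

Let inphi : mu.-integrable setT (EFin \o (fun t => `|phi t|)).
Proof. exact: integrable_norm. Qed.

Lemma continuous_comp_mulr (k : R -> R) (y : R) : continuous k ->
  continuous (fun t : R => k (t * y)).
Proof.
move=> ck t; apply: (cvg_comp (fun t => t * y) k _ (ck (t * y))).
by apply: cvgM; [exact: cvg_id|exact: cvg_cst].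
Qed.

Lemma measurable_trig_comp (k : R -> R) (y : R) : continuous k ->
  measurable_fun setT (fun t : R => k (t * y)).
Proof. by move=> ck; apply: continuous_measurable_fun; exact: continuous_comp_mulr. Qed.

(** For k = cos and k = sin, this is the continuity of the Fourier transform of
    an integrable phi, with respect to an arbitrary measure. *)
Lemma continuous_trig_integral (k : R -> R) : continuous k ->
  (forall x, `|k x| <= 1) ->
  continuous (fun y => \int[mu]_t (phi t * k (t * y))).
Proof.
move=> ck k1.
have := @continuous_Rintegral_dominated _ _ mu (fun y t => phi t * k (t * y))
  (fun t => `|phi t|); apply => //.
- by move=> y; apply: measurable_funM => //; exact: measurable_trig_comp.
- move=> t y; apply: cvgM; first exact: cvg_cst.
  apply: (cvg_comp (fun y => t * y) k _ (ck (t * y))).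
  by apply: cvgM; [exact: cvg_cst|exact: cvg_id].
- by move=> y t; rewrite normrM ler_piMr.
Qed.

End parametric.

(** * Tents and their cosine transforms *)

Section tent.
Context {R : realType}.
Local Notation leb := (@lebesgue_measure R).
Implicit Types s d t u x : R.

Definition tent s d t : R := Num.max 0 (1 - `|t - s| / d).

Lemma tent_ge0 s d t : 0 <= tent s d t.
Proof. by rewrite /tent le_max lexx. Qed.

Lemma tent_le1 s d t : 0 < d -> tent s d t <= 1.
Proof. by move=> d0; rewrite /tent ge_max ler01 gerBl divr_ge0// ltW. Qed.

Lemma tent_eq0 s d t : 0 < d -> d <= `|t - s| -> tent s d t = 0.
Proof.
move=> d0 dts; apply/max_idPl.
by rewrite subr_le0 ler_pdivlMr// mul1r.
Qed.

Lemma tentE s d t : 0 < d -> `|t - s| <= d -> tent s d t = 1 - `|t - s| / d.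
Proof.
move=> d0 dts; apply/max_idPr.
by rewrite subr_ge0 ler_pdivrMr// mul1r.
Qed.

Lemma continuous_tent s d : continuous (tent s d).
Proof.
move=> t; rewrite /tent.
apply: (@continuous_max _ _ (cst 0) (fun t => 1 - `|t - s| / d)); first exact: cvg_cst.
apply: cvgB; first exact: cvg_cst.
apply: cvgM; last exact: cvg_cst.
apply: cvg_norm; apply: cvgB; [exact: cvg_id|exact: cvg_cst].
Qed.

Lemma measurable_tent s d : measurable_fun setT (tent s d).
Proof. apply: continuous_measurable_fun; exact: continuous_tent. Qed.

Lemma tent_le_indic s d t : 0 < d -> tent s d t <= \1_(`[s - d, s + d]) t.
Proof.
move=> d0; have [h|h] := leP d `|t - s|.
  by rewrite tent_eq0// indicE.
rewrite indicE mem_set ?tent_le1//= in_itv/=.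
by rewrite -ler_distl ltW.
Qed.

Lemma integrable_tent s d : 0 < d -> leb.-integrable setT (EFin \o tent s d).
Proof.
move=> d0; apply: (le_integrable measurableT _ _
  (integrable_indic_itv (s - d) (s + d) true false)).
  by apply/measurable_EFinP; exact: measurable_tent.
move=> t _ /=; rewrite lee_fin ger0_norm ?tent_ge0//.
by rewrite (le_trans (tent_le_indic s t d0))// ler_norm.
Qed.

Lemma integral_tent_ge s d : 0 < d -> d / 2 <= \int[leb]_t tent s d t.
Proof.
move=> d0.
have -> : d / 2 = \int[leb]_t (2^-1 * \1_(`[s - d / 2, s + d / 2]) t).
  rewrite RintegralZl//; last exact: integrable_indic_itv.
  rewrite /Rintegral integral_indic// setIT. rewrite /= lebesgue_measure_itv/=.
  rewrite lte_fin ltrBlDr -addrA -splitr ltrDl d0 -EFinB/=; by field.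
apply: le_Rintegral => //.
- exact: (integrableZl measurableT 2^-1
    (integrable_indic_itv (s - d / 2) (s + d / 2) true false)).
- exact: integrable_tent.
- move=> t _; rewrite indicE; case: (boolP (t \in _)) => [|_]; last first.
    by rewrite mulr0 tent_ge0.
  rewrite inE/= in_itv/= -ler_distl mulr1 => h.
  rewrite tentE//; last by rewrite (le_trans h)//; lra.
  by rewrite lerBrDl -lerBrDr ler_pdivrMr// (le_trans h)//; lra.
Qed.

(** The Fourier transform of the tent up to the phase of its centre: being real,
    it lets the whole argument avoid complex-valued integrals. *)
Definition tentF s d u : R := \int[leb]_t (tent s d t * cos (t * u)).

Lemma tentFN s d u : tentF s d (- u) = tentF s d u.
Proof. by rewrite /tentF; under eq_Rintegral do rewrite mulrN cosN. Qed.

Lemma normr_cos_le1 x : `|cos x| <= 1.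
Proof. by rewrite ler_norml cos_geN1 cos_le1. Qed.

Lemma normr_sin_le1 x : `|sin x| <= 1.
Proof. by rewrite ler_norml sin_geN1 sin_le1. Qed.

Lemma continuous_tentF s d : 0 < d -> continuous (tentF s d).
Proof.
move=> d0; apply: continuous_trig_integral => //; first exact: integrable_tent.
  exact: continuous_cos.
exact: normr_cos_le1.
Qed.

Lemma measurable_tentF s d : 0 < d -> measurable_fun setT (tentF s d).
Proof. by move=> d0; apply: continuous_measurable_fun; exact: continuous_tentF. Qed.

Lemma integrable_tent_trig s d (k : R -> R) u : 0 < d -> continuous k ->
  (forall x, `|k x| <= 1) ->
  leb.-integrable setT (EFin \o (fun t => tent s d t * k (t * u))).
Proof.
move=> d0 ck k1; apply: (le_integrable measurableT _ _ (integrable_tent s d0)).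
  apply/measurable_EFinP; apply: measurable_funM; first exact: measurable_tent.
  exact: measurable_trig_comp.
by move=> t _ /=; rewrite lee_fin normrM ler_piMr.
Qed.

Lemma normr_tentF_le s d u : 0 < d -> `|tentF s d u| <= \int[leb]_t tent s d t.
Proof.
move=> d0; have ik : leb.-integrable setT (EFin \o (fun t => tent s d t * cos (t * u))).
  apply: integrable_tent_trig => //; [exact: continuous_cos|exact: normr_cos_le1].
rewrite (le_trans (le_normr_Rintegral _ ik))//.
apply: le_Rintegral => //; [exact: integrable_norm|exact: integrable_tent|].
by move=> t _; rewrite normrM ger0_norm ?tent_ge0// ler_piMr ?tent_ge0 ?normr_cos_le1.
Qed.

End tent.

Section tentF.
Context {R : realType}.
Local Notation leb := (@lebesgue_measure R).
Implicit Types s d t u x : R.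

(** Integration by parts, with the antiderivative written out. *)
Lemma integral_affine_cos (p q u a b : R) : u != 0 -> a < b ->
  \int[leb]_(t in `[a, b]) ((p + q * t) * cos (t * u)) =
  ((p + q * b) * sin (b * u) / u + q * cos (b * u) / u ^+ 2) -
  ((p + q * a) * sin (a * u) / u + q * cos (a * u) / u ^+ 2).
Proof.
move=> u0 ab.
pose H t : R := (p + q * t) * (sin (t * u) / u) + q * (cos (t * u) / u ^+ 2).
have dmul t : is_derive (t : R) 1 (fun t : R => t * u) u.
  by apply: is_derive_eq; rewrite scaler0 add0r /GRing.scale/= mulr1.
have dsin t : is_derive (t : R) 1 (fun t : R => sin (t * u)) (cos (t * u) * u).
  exact: (@is_derive1_comp _ sin (fun t => t * u) _ _ _ (is_derive_sin (t * u)) (dmul t)).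
have dcos t : is_derive (t : R) 1 (fun t : R => cos (t * u)) (- sin (t * u) * u).
  exact: (@is_derive1_comp _ cos (fun t => t * u) _ _ _ (is_derive_cos (t * u)) (dmul t)).
have dH t : is_derive (t : R) 1 H ((p + q * t) * cos (t * u)).
  apply: is_derive_eq; rewrite /GRing.scale/=. by field.
have cH : continuous H.
  move=> t; apply: differentiable_continuous; apply/derivable1_diffP.
  exact: (@ex_derive _ _ _ _ _ _ _ (dH t)).
rewrite /Rintegral (@continuous_FTC2 _ _ H)//.
- by rewrite /H/= !mulrA.
- apply: continuous_subspaceT => t; apply: cvgM.
    by apply: cvgD; [exact: cvg_cst|apply: cvgM; [exact: cvg_cst|exact: cvg_id]].
  by apply: continuous_comp_mulr; exact: continuous_cos.
- split=> [t _||].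
  + exact: (@ex_derive _ _ _ _ _ _ _ (dH t)).
  + by apply: cvg_at_right_filter; exact: cH.
  + by apply: cvg_at_left_filter; exact: cH.
- by move=> t _; rewrite derive1E (@derive_val _ _ _ _ _ _ _ (dH t)).
Qed.

(** The boundary terms in sin vanish at the ends of the tent and cancel at its
    apex; only the jumps of the slope contribute. For s = 0 this is the Fejer
    kernel. *)
Lemma tentFE s d u : 0 < d -> u != 0 ->
  tentF s d u = 2 * cos (s * u) * (1 - cos (d * u)) / (d * u ^+ 2).
Proof.
move=> d0 u0.
have sd : s - d < s by rewrite ltrBlDr ltrDl.
have sd' : s < s + d by rewrite ltrDl.
have ic : leb.-integrable setT (EFin \o (fun t => tent s d t * cos (t * u))).
  apply: integrable_tent_trig => //; [exact: continuous_cos|exact: normr_cos_le1].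
have icS (i : interval R) :
    leb.-integrable [set` i] (EFin \o (fun t => tent s d t * cos (t * u))).
  by apply: integrableS ic.
have -> : tentF s d u = \int[leb]_(t in `[s - d, s + d]) (tent s d t * cos (t * u)).
  rewrite /tentF [RHS]Rintegral_mkcond; apply: eq_Rintegral => t _.
  rewrite patchE; case: ifPn => // /negP; rewrite inE/= in_itv/= -ler_distl => /negP.
  by rewrite -ltNge => /ltW h; rewrite tent_eq0// mul0r.
have := @Rintegral_itvB _ (fun t => tent s d t * cos (t * u)) (BLeft (s - d)) (BRight (s + d)) s.
move=> /(_ (icS _)).
rewrite !bnd_simp => /(_ (ltW sd) (ltW sd')) /eqP.
rewrite subr_eq => /eqP ->.
rewrite Rintegral_itv_obnd_cbnd; last exact: icS.
have -> : \int[leb]_(t in `[s - d, s]) (tent s d t * cos (t * u)) =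
    \int[leb]_(t in `[s - d, s]) (((1 - s / d) + d^-1 * t) * cos (t * u)).
  apply: eq_Rintegral => t; rewrite inE/= in_itv/= => /andP[h1 h2].
  rewrite tentE// ler0_norm ?subr_le0//; last by rewrite opprB; lra.
  by congr (_ * _); field; rewrite gt_eqF.
have -> : \int[leb]_(t in `[s, s + d]) (tent s d t * cos (t * u)) =
    \int[leb]_(t in `[s, s + d]) (((1 + s / d) + (- d^-1) * t) * cos (t * u)).
  apply: eq_Rintegral => t; rewrite inE/= in_itv/= => /andP[h1 h2].
  rewrite tentE// ger0_norm ?subr_ge0//; last by lra.
  by congr (_ * _); field; rewrite gt_eqF.
rewrite !integral_affine_cos//.
have -> : (s - d) * u = s * u - d * u by ring.
have -> : (s + d) * u = s * u + d * u by ring.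
rewrite cosD cosB sinD sinB.
by field; rewrite u0 gt_eqF.
Qed.

(** The trivial bound by the integral of the tent is used near 0 and the closed
    form elsewhere; adding the two constants covers both cases at once. *)
Lemma tentF_decay s d : 0 < d -> exists C, 0 <= C /\ forall u, `|tentF s d u| <= C * (oneDsqr u)^-1.
Proof.
move=> d0; set I := \int[leb]_t tent s d t.
have I0 : 0 <= I by apply: Rintegral_ge0 => t _; exact: tent_ge0.
have d4 : 0 <= 4 / d by rewrite divr_ge0// ltW.
exists (I + 4 / d); split; first exact: addr_ge0.
move=> u; rewrite ler_pdivlMr ?oneDsqr_gt0//.
have [->|u0] := eqVneq u 0.
  rewrite /oneDsqr expr0n/= addr0 mulr1.
  by rewrite (le_trans (normr_tentF_le _ _ d0))// lerDl.
rewrite /oneDsqr mulrDr mulr1 lerD ?normr_tentF_le//.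
have u2 : 0 < u ^+ 2 by rewrite exprn_even_gt0.
rewrite -ler_pdivlMr// tentFE// normrM [X in _ * X]ger0_norm; last first.
  by rewrite invr_ge0 mulr_ge0 ?ltW.
rewrite (_ : 4 / d / u ^+ 2 = 4 / (d * u ^+ 2)); last first.
  by field; rewrite u0 gt_eqF.
rewrite ler_pM2r ?invr_gt0; last exact: mulr_gt0.
rewrite !normrM normr_nat.
have h2 : `|1 - cos (d * u)| <= 2.
  rewrite (le_trans (ler_normB _ _))// normr1.
  have := normr_cos_le1 (d * u); lra.
have := ler_pM (normr_ge0 _) (normr_ge0 _) (normr_cos_le1 (s * u)) h2.
lra.
Qed.

Lemma integrable_oneDsqrV : leb.-integrable setT (fun x : R => (oneDsqr x)^-1%:E).
Proof.
have cf : continuous (fun x : R => (oneDsqr x)^-1) by exact: continuous_oneDsqrV.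
have mf : measurable_fun setT (fun x : R => (oneDsqr x)^-1).
  by apply: continuous_measurable_fun.
apply/integrableP; split; first exact/measurable_EFinP.
under eq_integral.
  move=> x _; rewrite gee0_abs ?lee_fin ?invr_ge0 ?(le_trans _ (oneDsqr_ge1 x))//.
  over.
rewrite (@ge0_symfun_integralT _ (fun x => (oneDsqr x)^-1))//.
- by rewrite -set_itvcy integral0y_oneDsqr -EFinM ltry.
- by move=> x; rewrite /= /oneDsqr sqrrN.
Qed.

Lemma integrable_tentF s d : 0 < d -> leb.-integrable setT (EFin \o tentF s d).
Proof.
move=> d0; have [C [C0 hC]] := tentF_decay s d0.
apply: (le_integrable measurableT _ _ (integrableZl measurableT C integrable_oneDsqrV)).
  by apply/measurable_EFinP; exact: measurable_tentF.
move=> u _; rewrite /= lee_fin (le_trans (hC u))// ler_norm//.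
Qed.

End tentF.

(** * Averages of a transform against tents *)

Section tent_average.
Context {R : realType}.
Local Notation leb := (@lebesgue_measure R).

(** For a transform f = C + i S the integrand is tau(t) Re(e^(-ity) f(t)). *)
Definition tent_avg (s d : R) (C S : R -> R) (y : R) : R :=
  \int[leb]_t (tent s d t * (C t * cos (t * y) + S t * sin (t * y))).

Variable mu : {finite_measure set (measurableTypeR R) -> \bar R}.

Lemma integrable_bounded (f : R -> R) (M : R) : measurable_fun setT f ->
  (forall x, `|f x| <= M) -> mu.-integrable setT (EFin \o f).
Proof.
move=> mf fM; apply: (le_integrable measurableT _ _
  (finite_measure_integrable_cst mu M measurableT)).
  exact/measurable_EFinP.
by move=> x _ /=; rewrite lee_fin (le_trans (fM x))// ler_norm.
Qed.

Lemma integrable_trig (k : R -> R) (t : R) : continuous k ->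
  (forall x, `|k x| <= 1) -> mu.-integrable setT (EFin \o (fun x => k (t * x))).
Proof.
move=> ck k1; apply: (@integrable_bounded _ 1) => //.
rewrite (_ : (fun x => _) = (fun x => k (x * t))); first exact: measurable_trig_comp.
by apply/funext => x; rewrite mulrC.
Qed.

Let C t : R := \int[mu]_x cos (t * x).
Let S t : R := \int[mu]_x sin (t * x).

(** Addition formula for cos under the integral sign: the phase e^(-ity)
    translates the measure by y. *)
Lemma cos_shift_integral (t y : R) :
  C t * cos (t * y) + S t * sin (t * y) = \int[mu]_x cos (t * (x - y)).
Proof.
have iC : mu.-integrable setT (EFin \o (fun x => cos (t * x))).
  by apply: integrable_trig; [exact: continuous_cos|exact: normr_cos_le1].
have iS : mu.-integrable setT (EFin \o (fun x => sin (t * x))).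
  by apply: integrable_trig; [exact: continuous_sin|exact: normr_sin_le1].
rewrite /C /S -RintegralZr// -RintegralZr// -RintegralD//.
- by apply: eq_Rintegral => x _; rewrite mulrBr cosB.
- exact: (integrableZr measurableT (cos (t * y)) iC).
- exact: (integrableZr measurableT (sin (t * y)) iS).
Qed.

Lemma tent_avg_tentF (s d y : R) : 0 < d ->
  tent_avg s d C S y = \int[mu]_x tentF s d (x - y).
Proof.
move=> d0; rewrite /tent_avg.
transitivity (\int[leb]_t \int[mu]_x (tent s d t * cos (t * (x - y)))).
  apply: eq_Rintegral => t _; rewrite cos_shift_integral -RintegralZl//.
  apply: (@integrable_bounded _ 1) => [|x]; last exact: normr_cos_le1.
  apply: (measurableT_comp (f := cos)).
    by apply: continuous_measurable_fun; exact: continuous_cos.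
  by apply: measurable_funM => //; apply: measurable_funB.
rewrite (@Rintegral_Fubini _ _ _ _ _ leb mu
  (fun z => tent s d z.1 * cos (z.1 * (z.2 - y))) (tent s d) (cst 1))//.
- apply: measurable_funM.
    apply: (measurableT_comp (f := tent s d)) => //; exact: measurable_tent.
  apply: (measurableT_comp (f := cos)).
    by apply: continuous_measurable_fun; exact: continuous_cos.
  by apply: measurable_funM => //; apply: measurable_funB.
- exact: integrable_tent.
- by apply: (@integrable_bounded _ 1) => // x; rewrite normr1.
- by move=> t x /=; rewrite normrM ger0_norm ?tent_ge0// ler_wpM2l ?tent_ge0 ?normr_cos_le1.
Qed.

(** As tentF is even, the inner integral over y in ]a, b] of tentF(x - y) is the
    integral over u of tentF(u) restricted to x \in ]a - u, b - u] (put
    y = u + x); exchanging the integrals, x then integrates to the measure of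
    this interval. *)
Lemma integral_tentF_shift (s d a b : R) : 0 < d ->
  \int[leb]_(y in `]a, b]) \int[mu]_x tentF s d (x - y) =
  \int[leb]_u (tentF s d u * fine (mu `]a - u, b - u]%classic)).
Proof.
move=> d0; pose K0 := \int[leb]_t tent s d t.
have K00 : 0 <= K0 by apply: Rintegral_ge0 => t _; exact: tent_ge0.
pose I : R -> R := \1_(`]a, b]).
have mI : measurable_fun setT I by exact: measurable_indic.
have mk := measurable_tentF s d0.
have I0 y : 0 <= I y by [].
have I1 y : I y <= 1 by rewrite /I indicE; case: (_ \in _).
transitivity (\int[leb]_y \int[mu]_x (I y * tentF s d (x - y))).
  rewrite Rintegral_mkcond; apply: eq_Rintegral => y _.
  rewrite patchE /I; under [RHS]eq_Rintegral do rewrite indicE.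
  case: ifPn => _; first by under [RHS]eq_Rintegral do rewrite mul1r.
  under [RHS]eq_Rintegral do rewrite mul0r.
  by rewrite Rintegral_cst// mul0r.
rewrite (@Rintegral_Fubini _ _ _ _ _ leb mu
  (fun z => I z.1 * tentF s d (z.2 - z.1)) I (cst K0))/=; first last.
- move=> y x /=; rewrite normrM ger0_norm//.
  by rewrite ler_wpM2l// normr_tentF_le.
- by apply: (@integrable_bounded _ K0) => // x; rewrite ger0_norm.
- exact: integrable_indic_itv.
- apply: measurable_funM; first exact: measurableT_comp.
  by apply: (measurableT_comp (f := tentF s d)) => //; apply: measurable_funB.
transitivity (\int[mu]_x \int[leb]_u (I (u + x) * tentF s d u)).
  apply: eq_Rintegral => x _.
  rewrite (@Rintegral_affine _ 1 x (fun y => I y * tentF s d (x - y)))//; last first.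
    apply: (le_integrable measurableT _ _ (integrableZl measurableT K0
      (integrable_indic_itv a b false false))).
      apply/measurable_EFinP; apply: measurable_funM; first exact: mI.
      by apply: (measurableT_comp mk); apply: measurable_funB.
    move=> y _ /=; rewrite lee_fin !normrM mulrC (ger0_norm K00).
    by rewrite ler_wpM2r// normr_tentF_le.
  rewrite mul1r; apply: eq_Rintegral => u _; rewrite mul1r; congr (_ * _).
  by rewrite -tentFN; congr tentF; ring.
rewrite (@Rintegral_Fubini _ _ _ _ _ mu leb
  (fun z => I (z.2 + z.1) * tentF s d z.2) (cst 1) (fun u => `|tentF s d u|))/=; first last.
- by move=> x u /=; rewrite normrM ger0_norm// ler_wpM2r.
- exact/integrable_norm/integrable_tentF.
- by apply: (@integrable_bounded _ 1) => // x; rewrite normr1.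
- apply: measurable_funM; last exact: measurableT_comp.
  by apply: (measurableT_comp (f := I)) => //; apply: measurable_funD.
apply: eq_Rintegral => u _.
transitivity (\int[mu]_x (tentF s d u * \1_(`]a - u, b - u]) x)).
  apply: eq_Rintegral => x _; rewrite mulrC /I !indicE; congr (_ * _%:R).
  apply: congr1; apply/idP/idP; rewrite !inE/= !in_itv/=.
    by rewrite ltrBlDl lerBrDl.
  by rewrite ltrBlDl lerBrDl.
rewrite RintegralZl//; last first.
  apply: (@integrable_bounded _ 1) => // x.
  by rewrite ger0_norm// indicE; case: (_ \in _).
by rewrite /Rintegral integral_indic// setIT.
Qed.

(** The measure of the interval is the x-integral of a measurable function of
    (u, x), so this is part of Tonelli's theorem. *)
Lemma measurable_measure_itv_shift (a b : R) :
  measurable_fun setT (fun u : R => fine (mu `]a - u, b - u]%classic)).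
Proof.
pose I : R -> R := \1_(`]a, b]).
have mI : measurable_fun setT I by exact: measurable_indic.
pose f (z : measurableTypeR R * measurableTypeR R) : \bar R := (I (z.1 + z.2))%:E.
have mf : measurable_fun setT f.
  apply/measurable_EFinP; apply: (measurableT_comp (f := I)) => //.
  by apply: measurable_funD.
have f0 z : (0 <= f z)%E by rewrite lee_fin.
have mF := @measurable_fun_fubini_tonelli_F _ _ (measurableTypeR R)
  (measurableTypeR R) R mu f mf f0.
apply: measurableT_comp => //.
rewrite (_ : (fun u => _) = fubini_F mu f)//; apply/funext => u.
rewrite /fubini_F -[X in mu X]setIT -integral_indic//.
apply: eq_integral => x _; rewrite /f/= /I !indicE; congr (_%:R%:E).
apply: congr1; apply/idP/idP; rewrite !inE/= !in_itv/=.
  by rewrite ltrBlDl lerBrDl.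
by rewrite ltrBlDl lerBrDl.
Qed.

Lemma integral_tent_avg (s d a b : R) : 0 < d ->
  \int[leb]_(y in `]a, b]) tent_avg s d C S y =
  \int[leb]_u (tentF s d u * fine (mu `]a - u, b - u]%classic)).
Proof.
move=> d0; rewrite -integral_tentF_shift//.
by apply: eq_Rintegral => y _; rewrite tent_avg_tentF.
Qed.

End tent_average.

Section tent_average_regularity.
Context {R : realType}.
Local Notation leb := (@lebesgue_measure R).
Implicit Types (C S : R -> R) (s d y a b M : R).

Lemma integrable_itv_oc_bounded (f : R -> R) M a b : measurable_fun setT f ->
  (forall x, `|f x| <= M) -> leb.-integrable `]a, b] (EFin \o f).
Proof.
move=> mf fM; apply: measurable_bounded_integrable => //.
- by rewrite /= lebesgue_measure_itv/=; case: ifP => // _; rewrite -EFinB ltry.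
- exact: measurable_funTS.
- by exists M; split; [exact: num_real|move=> N MN x _; rewrite /= (le_trans (fM x))// ltW].
Qed.

Lemma integrable_tentM s d C M : 0 < d -> measurable_fun setT C ->
  (forall t, `|C t| <= M) -> leb.-integrable setT (EFin \o (fun t => tent s d t * C t)).
Proof.
move=> d0 mC CM.
apply: (le_integrable measurableT _ _ (integrableZl measurableT M (integrable_tent s d0))).
  by apply/measurable_EFinP; apply: measurable_funM => //; exact: measurable_tent.
move=> t _ /=; rewrite lee_fin !normrM mulrC (ger0_norm (tent_ge0 s d t)).
by rewrite ler_wpM2r ?tent_ge0// (le_trans (CM t))// ler_norm.
Qed.

Section regularity.
Variables (s d M : R) (C S : R -> R).
Hypotheses (d0 : 0 < d) (mC : measurable_fun setT C) (mS : measurable_fun setT S).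
Hypotheses (CM : forall t, `|C t| <= M) (SM : forall t, `|S t| <= M).

Let iTC := integrable_tentM s d0 mC CM.
Let iTS := integrable_tentM s d0 mS SM.

Lemma integrable_tentM_trig (D k : R -> R) y : measurable_fun setT D ->
  (forall t, `|D t| <= M) -> continuous k -> (forall x, `|k x| <= 1) ->
  leb.-integrable setT (EFin \o (fun t => tent s d t * D t * k (t * y))).
Proof.
move=> mD DM ck k1.
apply: (le_integrable measurableT _ _ (integrable_tentM s d0 mD DM)).
  apply/measurable_EFinP; apply: measurable_funM; last exact: measurable_trig_comp.
  by apply: measurable_funM => //; exact: measurable_tent.
by move=> t _ /=; rewrite lee_fin normrM ler_piMr.
Qed.

Lemma tent_avgE y : tent_avg s d C S y =
  \int[leb]_t (tent s d t * C t * cos (t * y)) +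
  \int[leb]_t (tent s d t * S t * sin (t * y)).
Proof.
rewrite -RintegralD//.
- by apply: eq_Rintegral => t _; rewrite mulrDr !mulrA.
- by apply: integrable_tentM_trig => //; [exact: continuous_cos|exact: normr_cos_le1].
- by apply: integrable_tentM_trig => //; [exact: continuous_sin|exact: normr_sin_le1].
Qed.

Lemma continuous_tent_avg : continuous (tent_avg s d C S).
Proof.
rewrite (funext tent_avgE) => y; apply: cvgD.
  exact: (continuous_trig_integral iTC (@continuous_cos R) normr_cos_le1).
exact: (continuous_trig_integral iTS (@continuous_sin R) normr_sin_le1).
Qed.

Lemma measurable_tent_avg : measurable_fun setT (tent_avg s d C S).
Proof. by apply: continuous_measurable_fun; exact: continuous_tent_avg. Qed.

Lemma normr_tent_avg_le y :
  `|tent_avg s d C S y| <= M *+ 2 * \int[leb]_t tent s d t.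
Proof.
have M0 : 0 <= M := le_trans (normr_ge0 _) (CM 0).
have bnd (D k : R -> R) : measurable_fun setT D -> (forall t, `|D t| <= M) ->
    continuous k -> (forall x, `|k x| <= 1) ->
    `|\int[leb]_t (tent s d t * D t * k (t * y))| <= M * \int[leb]_t tent s d t.
  move=> mD DM ck k1; have it := integrable_tentM_trig y mD DM ck k1.
  rewrite (le_trans (le_normr_Rintegral _ it))// -RintegralZl//; last exact: integrable_tent.
  apply: le_Rintegral => //; first exact: integrable_norm.
    exact: (integrableZl measurableT M (integrable_tent s d0)).
  move=> t _; rewrite !normrM (ger0_norm (tent_ge0 s d t)) -mulrA mulrC.
  by rewrite ler_wpM2r ?tent_ge0// -[leRHS]mulr1 ler_pM.
rewrite tent_avgE (le_trans (ler_normD _ _))// mulr2n mulrDl lerD ?bnd//.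
- exact: continuous_cos.
- exact: normr_cos_le1.
- exact: continuous_sin.
- exact: normr_sin_le1.
Qed.

End regularity.

Lemma tent_avgB s d M C1 S1 C2 S2 y : 0 < d ->
  measurable_fun setT C1 -> measurable_fun setT S1 ->
  measurable_fun setT C2 -> measurable_fun setT S2 ->
  (forall t, `|C1 t| <= M) -> (forall t, `|S1 t| <= M) ->
  (forall t, `|C2 t| <= M) -> (forall t, `|S2 t| <= M) ->
  tent_avg s d (C1 \- C2) (S1 \- S2) y =
  tent_avg s d C1 S1 y - tent_avg s d C2 S2 y.
Proof.
move=> d0 mC1 mS1 mC2 mS2 C1M S1M C2M S2M.
have it C S : measurable_fun setT C -> measurable_fun setT S ->
    (forall t, `|C t| <= M) -> (forall t, `|S t| <= M) ->
    leb.-integrable setT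
      (EFin \o (fun t => tent s d t * (C t * cos (t * y) + S t * sin (t * y)))).
  move=> mC mS CM SM.
  have iD := integrableD measurableT
    (integrable_tentM_trig s d0 y mC CM (@continuous_cos R) normr_cos_le1)
    (integrable_tentM_trig s d0 y mS SM (@continuous_sin R) normr_sin_le1).
  apply: eq_integrable iD; first exact: measurableT.
  by move=> t _ /=; rewrite mulrDr !mulrA.
rewrite /tent_avg -RintegralB//; [|exact: it|exact: it].
by apply: eq_Rintegral => t _ /=; ring.
Qed.

End tent_average_regularity.

(** * Stieltjes measures of functions of bounded variation *)

Section stieltjes_measures.
Context {R : realType}.
Implicit Types (G : R -> R) (m : {measure set (measurableTypeR R) -> \bar R}).

Lemma measure_eq_ocitv m1 m2 :
  (forall a b : R, m1 `]a, b]%classic = m2 `]a, b]%classic) ->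
  (forall a b : R, (m1 `]a, b]%classic < +oo)%E) ->
  forall A, measurable A -> m1 A = m2 A.
Proof.
move=> m12 m1oo A mA.
refine (@g_sigma_algebra_measure_unique _ R (measurableTypeR R) (@ocitv R) _
  (fun n : nat => `]- (n%:R : R), n%:R]%classic) _ _ m1 m2 _ _ _ A mA) => //.
- by move=> X oX; exact: sub_sigma_algebra.
- by move=> i; exact: is_ocitv.
- exact: (bigcup_itvT false false).
- exact: ocitvI.
- by move=> _ [[a b] _ <-].
Qed.

Lemma cvg_measure_symmetric_itv m :
  m `]- (n%:R : R), n%:R]%classic @[n --> \oo] --> m setT.
Proof.
rewrite -(bigcup_itvT false false).
apply: nondecreasing_cvg_mu => //.
  exact: bigcup_measurable.
by move=> i j ij; apply/subsetPset/subset_itv; rewrite leBSide/= ?lerN2 ler_nat.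
Qed.

Lemma measure_setT_le m (M : R) :
  (forall n : nat, (m `](- n%:R)%R, n%:R%R]%classic <= M%:E)%E) ->
  (m setT <= M%:E)%E.
Proof.
move=> mM; have cv := @cvg_measure_symmetric_itv m.
rewrite -(cvg_lim _ cv)//; apply: lime_le; first by apply/cvg_ex; eexists; exact: cv.
exact: nearW.
Qed.

Lemma total_variationR_ge0 G : (0 <= total_variationR G)%E.
Proof.
apply: le_trans (total_variation_ge0 G (lexx 0)) _.
by apply: ereal_sup_ubound; exists (0, 0) => /=.
Qed.

Lemma normr_diff_le_total_variationR G a b : (total_variationR G < +oo)%E ->
  a <= b -> `|G b - G a| <= fine (total_variationR G).
Proof.
move=> GV ab; rewrite -lee_fin fineK ?ge0_fin_numE ?total_variationR_ge0//.
rewrite (le_trans (total_variation_ge G ab))//.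
by apply: ereal_sup_ubound; exists (a, b).
Qed.

(** F is the total variation counted from the origin and N = F - G. They are not
    normalised at -oo; only their increments matter. *)
Lemma variation_function G : (total_variationR G < +oo)%E -> right_continuous G ->
  exists F N : cumulative R R, [/\ forall x, G x = F x - N x,
    forall a b, a <= b -> F b - F a <= fine (total_variationR G) &
    forall a b, a <= b -> N b - N a <= fine (total_variationR G) *+ 2].
Proof.
move=> GV Grc; set V := fine _.
have TVle a b : a <= b -> (total_variation a b G <= total_variationR G)%E.
  by move=> ab; apply: ereal_sup_ubound; exists (a, b).
have TVfin a b : a <= b -> total_variation a b G \is a fin_num.
  move=> ab; rewrite ge0_fin_numE ?total_variation_ge0//.
  exact: le_lt_trans (TVle _ _ ab) GV.
pose tv a b := fine (total_variation a b G).
have tvD a b c : a <= c -> c <= b -> tv a b = tv a c + tv c b.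
  by move=> ac cb; rewrite /tv (total_variationD G ac cb) fineD ?TVfin.
have tvV a b : a <= b -> tv a b <= V.
  by move=> ab; rewrite fine_le ?TVfin ?TVle// ge0_fin_numE ?total_variationR_ge0.
have tvG a b : a <= b -> `|G b - G a| <= tv a b.
  by move=> ab; rewrite -lee_fin fineK ?TVfin ?total_variation_ge.
pose F x := if 0 <= x then tv 0 x else - tv x 0.
have FB x y : x <= y -> F y - F x = tv x y.
  move=> xy; rewrite /F; case: (leP 0 x) => x0.
    by rewrite (le_trans x0 xy) (tvD 0 y x)// addrAC subrr add0r.
  rewrite opprK; case: (leP 0 y) => y0.
    by rewrite (tvD x y 0) ?(ltW x0)//; ring.
  by rewrite (tvD x 0 y) ?(ltW x0) ?(ltW y0)//; ring.
have Fnd : nondecreasing F.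
  by move=> x y xy; rewrite -subr_ge0 FB// (le_trans _ (tvG _ _ xy)).
have Frc : right_continuous F.
  move=> x; have xx1 : x < x + 1 by rewrite ltrDl.
  have cvtv : tv x t @[t --> x^'+] --> tv x x.
    apply: (@total_variation_right_continuous R x (x + 1) x G) => //.
    by apply/bounded_variationP; [exact: ltW|apply: TVfin; exact: ltW].
  have -> : F x = F x + tv x x by rewrite /tv total_variationxx addr0.
  apply: cvg_trans (cvgD (cvg_cst (F x)) cvtv).
  apply: near_eq_cvg; near=> t => /=.
  have xt : x <= t by [].
  by transitivity (F x + tv x t) => //; rewrite -FB// addrC subrK.
have Nnd : nondecreasing (F \- G).
  move=> x y xy; rewrite -subr_ge0/=.
  have := tvG _ _ xy; rewrite -FB// => /(le_trans (ler_norm _)); lra.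
have Nrc : right_continuous (F \- G) by move=> x; apply: cvgB; [exact: Frc|exact: Grc].
pose cF : cumulative R R := HB.pack F (isCumulative.Build R _ R F Fnd Frc).
pose cN : cumulative R R :=
  HB.pack (F \- G) (isCumulative.Build R _ R (F \- G) Nnd Nrc).
exists cF, cN.
split => [x|a b ab|a b ab] /=.
- by rewrite opprB addrC subrK.
- by rewrite FB// tvV.
- have := tvV _ _ ab; have := tvG _ _ ab; rewrite -FB// ler_norml => /andP[]; lra.
Unshelve. all: by end_near. Qed.

(** charge_integral is defined from the Jordan parts of the charge, so the only
    issue is the size of these parts. The two sums of measures mp + dN and
    mn + dF agree on the intervals ]a, b], hence on all Borel sets. Evaluated on
    the positive part of a Hahn decomposition, where mn vanishes and mp has its
    whole mass, this bounds mp by dF; symmetrically mn is bounded by dN. *)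
Lemma class_V_jordan G : class_V G ->
  exists mp mn : {finite_measure set (measurableTypeR R) -> \bar R},
  [/\ forall a b, a <= b ->
        G b - G a = fine (mp `]a, b]%classic) - fine (mn `]a, b]%classic),
      forall f, charge_integral (ls_charge G) f = \int[mp]_x f x - \int[mn]_x f x,
      fine (mp setT) <= fine (total_variationR G) &
      fine (mn setT) <= fine (total_variationR G) *+ 2].
Proof.
move=> GV; have nuE := ls_chargeP GV; set nu := ls_charge G in nuE *.
exists (jordan_pos (hahn_pos_neg nu)), (jordan_neg (hahn_pos_neg nu)).
set mp := jordan_pos _; set mn := jordan_neg _.
have nuA A : measurable A -> nu A = (mp A - mn A)%E.
  by move=> mA; rewrite (jordan_decomp (hahn_pos_neg nu) mA) /cadd/= cscaleN1.
have [F [N [GE FV NV]]] := variation_function (let: And3 h _ _ := GV in h)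
  (let: And3 _ h _ := GV in h).
pose V := fine (total_variationR G); rewrite -/V.
have lsE (f : cumulative R R) (a b : R) : a <= b ->
    lebesgue_stieltjes_measure f `]a, b]%classic = (f b - f a)%:E.
  exact: ls_measure_itv_oc.
have lsT (f : cumulative R R) (M : R) : (forall a b, a <= b -> f b - f a <= M) ->
    (lebesgue_stieltjes_measure f setT <= M%:E)%E.
  move=> fM; apply: measure_setT_le => n.
  by rewrite /= lsE ?lee_fin ?fM// ge0_cp.
have fin_mp A : measurable A -> mp A \is a fin_num by exact: fin_num_measure.
have fin_mn A : measurable A -> mn A \is a fin_num by exact: fin_num_measure.
have mpn (a b : R) : a <= b ->
    G b - G a = fine (mp `]a, b]%classic) - fine (mn `]a, b]%classic).
  move=> ab; apply: EFin_inj; rewrite -(nuE _ _ ab) nuA//.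
  by rewrite EFinB !fineK ?fin_mp ?fin_mn.
have mFN A : measurable A -> (mp A + lebesgue_stieltjes_measure N A =
    mn A + lebesgue_stieltjes_measure F A)%E.
  move=> mA; rewrite -!measure_addE.
  apply: measure_eq_ocitv => // a b; last rewrite [ltLHS]measure_addE.
    rewrite [LHS]measure_addE [RHS]measure_addE.
    have [ab|ba] := leP a b; last first.
      by rewrite set_itv_ge ?bnd_simp -?leNgt ?(ltW ba)// !measure0.
    have := mpn _ _ ab; rewrite /= !lsE// !GE.
    have := fin_mp `]a, b]%classic (measurable_itv _).
    have := fin_mn `]a, b]%classic (measurable_itv _).
    rewrite -/mp -/mn.
    case: (mn _) => // n _; case: (mp _) => // p _ /= h.
    by rewrite -!EFinD; congr EFin; lra.
  apply: lte_add_pinfty; first by rewrite ltey_eq fin_mp.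
  have [ab|ba] := leP a b; first by rewrite /= lsE// ltry.
  by rewrite set_itv_ge ?bnd_simp -?leNgt ?(ltW ba)// measure0.
have [[mP _] [mN _] _ PN0] := hahn_pos_neg nu.
have mpT : mp setT = mp (hahn_pos nu).
  rewrite /mp !jordan_posE !cjordan_posE /crestr0 !mem_set// /crestr.
  by rewrite setTI setIid.
have mnT : mn setT = mn (hahn_neg nu).
  rewrite /mn !jordan_negE !cjordan_negE /crestr0 !mem_set// /crestr.
  by rewrite setTI setIid.
have mnP : mn (hahn_pos nu) = 0%E.
  by rewrite /mn jordan_negE cjordan_negE /crestr0 mem_set// /crestr PN0 charge0 oppe0.
have mpN : mp (hahn_neg nu) = 0%E.
  by rewrite /mp jordan_posE cjordan_posE /crestr0 mem_set// /crestr setIC PN0 charge0.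
split => //.
- rewrite -lee_fin fineK ?fin_mp// [leLHS]mpT.
  have := mFN _ mP; rewrite mnP add0e => mE.
  apply: le_trans (lsT F V FV).
  apply: (@le_trans _ _ (lebesgue_stieltjes_measure F (hahn_pos nu))).
    by rewrite -mE leeDl.
  by apply: le_measure; rewrite ?inE.
- rewrite -lee_fin fineK ?fin_mn// [leLHS]mnT.
  have := mFN _ mN; rewrite mpN add0e => mE.
  apply: le_trans (lsT N (V *+ 2) NV).
  apply: (@le_trans _ _ (lebesgue_stieltjes_measure N (hahn_neg nu))).
    by rewrite mE leeDl.
  by apply: le_measure; rewrite ?inE.
Qed.
End stieltjes_measures.

(** * The Fourier-Stieltjes transform on the class V *)

Section fourier_of_class_V.
Context {R : realType}.
Local Notation leb := (@lebesgue_measure R).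
Implicit Types (G : R -> R) (s d a b t : R).

Definition cosT G t : R := charge_integral (ls_charge G) (fun x => cos (t * x)).
Definition sinT G t : R := charge_integral (ls_charge G) (fun x => sin (t * x)).

Lemma fourier_stieltjesE G t : fourier_stieltjes G t = (cosT G t +i* sinT G t)%C.
Proof. by []. Qed.

Lemma continuous_trig_transform (mu : {finite_measure set (measurableTypeR R) -> \bar R})
    (k : R -> R) : continuous k -> (forall x, `|k x| <= 1) ->
  continuous (fun t => \int[mu]_x k (t * x)).
Proof.
move=> ck k1.
have i1 : mu.-integrable setT (EFin \o (fun x => 1 : R)).
  by apply: (@integrable_bounded _ mu _ 1) => // x; rewrite normr1.
have -> : (fun t => \int[mu]_x k (t * x)) =
    (fun t => \int[mu]_x ((fun=> 1) x * k (x * t))).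
  by apply/funext => t; apply: eq_Rintegral => x _; rewrite mul1r mulrC.
exact: (continuous_trig_integral i1 ck k1).
Qed.

Lemma normr_trig_transform_le (mu : {finite_measure set (measurableTypeR R) -> \bar R})
    (k : R -> R) t : continuous k -> (forall x, `|k x| <= 1) ->
  `|\int[mu]_x k (t * x)| <= fine (mu setT).
Proof.
move=> ck k1; have it := integrable_trig mu t ck k1.
rewrite (le_trans (le_normr_Rintegral _ it))//.
have -> : fine (mu setT) = \int[mu]_x 1 by rewrite Rintegral_cst// mul1r.
apply: le_Rintegral => //; first exact: integrable_norm.
by apply: (@integrable_bounded _ mu _ 1) => // x; rewrite normr1.
Qed.

Section class_V.
Variable G : R -> R.
Hypothesis GV : class_V G.
Let V := fine (total_variationR G).

Let V0 : 0 <= V.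
Proof. by rewrite fine_ge0 ?total_variationR_ge0. Qed.

Let trigT (k : R -> R) t := charge_integral (ls_charge G) (fun x => k (t * x)).

(* the Jordan parts have masses at most V and 2 V *)
Let trigT_regular (k : R -> R) : continuous k -> (forall x, `|k x| <= 1) ->
  continuous (trigT k) /\ forall t, `|trigT k t| <= V *+ 3.
Proof.
move=> ck k1; have [mp [mn [_ TE mpV mnV]]] := class_V_jordan GV.
have -> : trigT k = fun t => \int[mp]_x k (t * x) - \int[mn]_x k (t * x).
  by apply/funext => t; rewrite /trigT TE.
split=> [t|t].
  by apply: cvgB; exact: continuous_trig_transform.
rewrite (le_trans (ler_normB _ _))// [leRHS]mulrS lerD//.
  by rewrite (le_trans (normr_trig_transform_le mp t ck k1)).
by rewrite (le_trans (normr_trig_transform_le mn t ck k1)).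
Qed.

Lemma continuous_cosT : continuous (cosT G).
Proof. by have [] := trigT_regular (@continuous_cos R) normr_cos_le1. Qed.

Lemma continuous_sinT : continuous (sinT G).
Proof. by have [] := trigT_regular (@continuous_sin R) normr_sin_le1. Qed.

Lemma normr_cosT_le t : `|cosT G t| <= V *+ 3.
Proof. by have [_] := trigT_regular (@continuous_cos R) normr_cos_le1; exact. Qed.

Lemma normr_sinT_le t : `|sinT G t| <= V *+ 3.
Proof. by have [_] := trigT_regular (@continuous_sin R) normr_sin_le1; exact. Qed.

Lemma measurable_cosT : measurable_fun setT (cosT G).
Proof. by apply: continuous_measurable_fun; exact: continuous_cosT. Qed.

Lemma measurable_sinT : measurable_fun setT (sinT G).
Proof. by apply: continuous_measurable_fun; exact: continuous_sinT. Qed.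

(** The key identity: it links averages of the transform to increments of G. *)
Lemma integral_tent_avg_fourier s d a b : 0 < d -> a <= b ->
  \int[leb]_(y in `]a, b]) tent_avg s d (cosT G) (sinT G) y =
  \int[leb]_u (tentF s d u * (G (b - u) - G (a - u))).
Proof.
move=> d0 ab; have [mp [mn [GE TE mpV mnV]]] := class_V_jordan GV.
pose C (mu : {finite_measure set (measurableTypeR R) -> \bar R}) t := \int[mu]_x cos (t * x).
pose S (mu : {finite_measure set (measurableTypeR R) -> \bar R}) t := \int[mu]_x sin (t * x).
have mC mu : measurable_fun setT (C mu).
  apply: continuous_measurable_fun; apply: continuous_trig_transform.
    exact: continuous_cos.
  exact: normr_cos_le1.
have mS mu : measurable_fun setT (S mu).
  apply: continuous_measurable_fun; apply: continuous_trig_transform.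
    exact: continuous_sin.
  exact: normr_sin_le1.
pose M := V *+ 2.
have VM : V <= M by rewrite /M mulr2n lerDl.
have Cp t : `|C mp t| <= M.
  rewrite (le_trans (normr_trig_transform_le mp t (@continuous_cos R) normr_cos_le1))//.
  exact: le_trans mpV VM.
have Sp t : `|S mp t| <= M.
  rewrite (le_trans (normr_trig_transform_le mp t (@continuous_sin R) normr_sin_le1))//.
  exact: le_trans mpV VM.
have Cn t : `|C mn t| <= M.
  by rewrite (le_trans (normr_trig_transform_le mn t (@continuous_cos R) normr_cos_le1)).
have Sn t : `|S mn t| <= M.
  by rewrite (le_trans (normr_trig_transform_le mn t (@continuous_sin R) normr_sin_le1)).
have -> : cosT G = C mp \- C mn by apply/funext => t; rewrite /cosT TE.
have -> : sinT G = S mp \- S mn by apply/funext => t; rewrite /sinT TE.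
under eq_Rintegral do rewrite (@tent_avgB _ _ _ M)//.
have iA mu : (forall t, `|C mu t| <= M) -> (forall t, `|S mu t| <= M) ->
    leb.-integrable `]a, b] (EFin \o tent_avg s d (C mu) (S mu)).
  move=> CM SM; apply: integrable_itv_oc_bounded; first exact: measurable_tent_avg CM SM.
  by move=> y; exact: normr_tent_avg_le.
rewrite RintegralB//; [|exact: iA|exact: iA].
have iK (mu : {finite_measure set (measurableTypeR R) -> \bar R}) :
    leb.-integrable setT
      (EFin \o (fun u => tentF s d u * fine (mu `]a - u, b - u]%classic))).
  have muT : mu setT \is a fin_num by exact: fin_num_measure.
  apply: (le_integrable measurableT _ _
    (integrableZr measurableT (fine (mu setT)) (integrable_norm (integrable_tentF s d0)))).
    apply/measurable_EFinP; apply: measurable_funM; first exact: measurable_tentF.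
    exact: measurable_measure_itv_shift.
  move=> u _ /=; rewrite lee_fin !normrM normr_id ler_wpM2l// !ger0_norm ?fine_ge0//.
  by rewrite fine_le ?fin_num_measure// le_measure ?inE.
rewrite !integral_tent_avg// -RintegralB//.
by apply: eq_Rintegral => u _; rewrite -mulrBr -GE ?lerD2r//.
Qed.

Lemma measurable_increment a b : a <= b ->
  measurable_fun setT (fun u : R => G (b - u) - G (a - u)).
Proof.
move=> ab; have [mp [mn [GE _ _ _]]] := class_V_jordan GV.
rewrite (_ : (fun u => _) = fun u =>
    fine (mp `]a - u, b - u]%classic) - fine (mn `]a - u, b - u]%classic)).
  by apply: measurable_funB; exact: measurable_measure_itv_shift.
by apply/funext => u; rewrite GE// lerD2r.
Qed.

Lemma normr_increment_le x y : `|G x - G y| <= V.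
Proof.
have [GVoo _ _] := GV.
have [xy|/ltW yx] := leP x y; last exact: normr_diff_le_total_variationR.
by rewrite distrC; exact: normr_diff_le_total_variationR.
Qed.

(** The transform at 0 is the total mass of dG, the limit of the masses
    G(n) - G(-n) of ]-n, n], where G(-n) tends to 0. *)
Lemma cvg_pinfty_cosT0 : G x @[x --> +oo] --> cosT G 0.
Proof.
have [GVoo Grc GNy] := GV.
have [F [N [GFN FV NV]]] := variation_function GVoo Grc.
have cvgF (H : cumulative R R) M : (forall a b, a <= b -> H b - H a <= M) ->
    cvg (H x @[x --> +oo]).
  move=> HM; apply/cvg_ex; eexists; apply: nondecreasing_cvgr.
    exact: cumulative_is_nondecreasing.
  exists (M + H 0) => _ [x _ <-]; rewrite -lerBlDr.
  have [x0|/ltW x0] := leP 0 x; first exact: HM.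
  rewrite (le_trans _ (HM 0 0 (lexx 0)))// lerB//.
  exact: cumulative_is_nondecreasing.
have cvG : cvg (G x @[x --> +oo]).
  rewrite (funext GFN); apply: is_cvgB; [exact: cvgF FV|exact: cvgF NV].
have ny : (n%:R : R) @[n --> \oo] --> +oo.
  by apply/cvgryPge; exact: nbhs_infty_ger.
have nNy : (- n%:R : R) @[n --> \oo] --> -oo by apply/cvgNry; rewrite opprK.
have [mp [mn [GE TE _ _]]] := class_V_jordan GV.
have cvm (m : {finite_measure set (measurableTypeR R) -> \bar R}) :
    fine (m `]- (n%:R : R), n%:R]%classic) @[n --> \oo] --> fine (m setT).
  apply: fine_cvg; rewrite fineK ?fin_num_measure//.
  exact: cvg_measure_symmetric_itv.
have T0 : cosT G 0 = fine (mp setT) - fine (mn setT).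
  rewrite /cosT TE; congr (_ - _).
    by under eq_Rintegral do rewrite mul0r cos0; rewrite Rintegral_cst// mul1r.
  by under eq_Rintegral do rewrite mul0r cos0; rewrite Rintegral_cst// mul1r.
have cvGn : G n%:R @[n --> \oo] --> cosT G 0.
  rewrite -[cosT G 0]addr0 T0.
  have -> : (fun n : nat => G n%:R) = (fun n : nat =>
      fine (mp `]- (n%:R : R), n%:R]%classic) -
      fine (mn `]- (n%:R : R), n%:R]%classic) + G (- n%:R)).
    by apply/funext => n; rewrite -GE ?subrK// ge0_cp.
  apply: cvgD; first by apply: cvgB; exact: cvm.
  by move/cvg_ninftyP : GNy; exact.
have cvGl := (cvg_pinftyP _ _).1 cvG _ ny.
by rewrite -(cvg_unique _ cvGl cvGn).
Qed.

End class_V.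
End fourier_of_class_V.

(** * Functions determined by their integrals *)

Section localisation.
Context {R : realType}.
Local Notation leb := (@lebesgue_measure R).

(** At a Lebesgue point s of k, the vanishing of the tent average gives
    |k(s)| int tau <= int tau |k - k(s)|. Since tau <= 1 vanishes off ball s r
    and has integral at least r / 2, this bounds |k(s)| by four times the mean
    deviation of k from k(s) on that ball, which tends to 0 with r. *)
Lemma ae_eq0_tent (k : R -> R) (M : R) : measurable_fun setT k ->
  (forall t, `|k t| <= M) ->
  (forall s d, 0 < d -> \int[leb]_t (tent s d t * k t) = 0) ->
  {ae leb, forall t, k t = 0}.
Proof.
move=> mk kM k0.
have lk : locally_integrable setT k.
  split => // [|K _ cK]; first exact: openT.
  have mK : measurable K := compact_measurable cK.
  apply: (@le_lt_trans _ _ (M%:E * leb K)%E).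
    apply: (@integral_le_bound _ _ _ leb K (EFin \o k)) => //.
      by apply/measurable_EFinP; exact: measurable_funTS.
      by rewrite lee_fin (le_trans (normr_ge0 (k 0))).
    by apply: aeW => x _; rewrite lee_fin.
  by rewrite lte_mul_pinfty// ?lee_fin ?(le_trans (normr_ge0 (k 0)))//
    compact_finite_measure.
apply: (@filterS _ _ (ae_filter_ringOfSetsType leb) _ _ _
  (lebesgue_differentiation lk)) => s ptk.
apply/eqP; rewrite -normr_le0; apply/ler_addgt0Pr => e e0; rewrite add0r.
have e40 : 0 < e / 4 by lra.
have : \forall r \near (0:R)^'+, (davg k s r < (e / 4)%:E)%E.
  have e4 : (0%:E < (e / 4)%:E)%E by rewrite lte_fin.
  exact: (ptk _ (open_ereal_lt' e4)).
move=> near_small; near (0:R)^'+ => r.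
have r0 : 0 < r by [].
have : (davg k s r < (e / 4)%:E)%E by near: r.
have bs : measurable (ball s r : set R) by exact: measurable_ball.
have icen : leb.-integrable (ball s r) (EFin \o (fun t => k t - k s)).
  apply: measurable_bounded_integrable => //.
  - by rewrite /= lebesgue_measure_ball ?ltry// ltW.
  - by apply: measurable_funTS; apply: measurable_funB.
  - exists (M + M); split; first exact: num_real.
    move=> N MN t _ /=; rewrite (le_trans (ler_normB _ _))// (le_trans _ (ltW MN))//.
    by rewrite lerD.
have JE : (\int[leb]_(t in ball s r) `|(k t - k s)%:E| =
    (\int[leb]_(t in ball s r) `|k t - k s|)%:E)%E.
  rewrite /Rintegral fineK//; apply: integrable_fin_num => //.
  exact: (integrable_norm icen).
rewrite /davg /iavg lebesgue_measure_ball ?(ltW r0)//.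
rewrite (_ : (\int[leb]_(t in ball s r) _)%E =
  (\int[leb]_(t in ball s r) `|k t - k s|)%:E)//.
rewrite inver gt_eqF ?mulrn_wgt0// -EFinM lte_fin mulrC ltr_pdivrMr ?mulrn_wgt0//.
set J := \int[leb]_(t in _) _ => Jlt.
have itM := integrable_tentM s r0 mk kM.
have its := integrableZl measurableT (k s) (integrable_tent s r0).
have ksJ : `|k s| * (r / 2) <= J.
  apply: (@le_trans _ _ (`|k s| * \int[leb]_t tent s r t)).
    by rewrite ler_wpM2l// integral_tent_ge.
  rewrite -[X in _ * X]ger0_norm; last by apply: Rintegral_ge0 => t _; exact: tent_ge0.
  rewrite -normrM -RintegralZl//; last exact: integrable_tent.
  rewrite -[X in `|X|]subr0 -(k0 s r r0) -RintegralB//.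
  rewrite (le_trans (le_normr_Rintegral _ (integrableB measurableT its itM)))//.
  rewrite /J [leRHS]Rintegral_mkcond; apply: le_Rintegral => //.
  - exact: (integrable_norm (integrableB measurableT its itM)).
  - by rewrite -restrict_EFin; apply/integrable_restrict => //;
      rewrite setTI; exact: (integrable_norm icen).
  - move=> t _; rewrite patchE /= mulrC -mulrBr normrM (ger0_norm (tent_ge0 s r t)).
    case: ifPn => [_|tb]; first by rewrite distrC ler_piMl// tent_le1.
    rewrite tent_eq0 ?mul0r//; rewrite leNgt; apply: contra tb => ts.
    by rewrite inE /ball/= distrC.
rewrite leNgt; apply/negP => eks.
have : e * (r / 2) < `|k s| * (r / 2) by rewrite ltr_pM2r// divr_gt0.
rewrite ltNge => /negP; apply; rewrite (le_trans ksJ)// (le_trans (ltW Jlt))//.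
rewrite mulr2n; lra.
Unshelve. all: by end_near. Qed.

Lemma integrable_itv_oc_continuous (h : R -> R) (a b : R) : continuous h ->
  leb.-integrable `]a, b] (EFin \o h).
Proof.
move=> ch; have : leb.-integrable `[a, b] (EFin \o h).
  apply: continuous_compact_integrable; first exact: segment_compact.
  exact: continuous_subspaceT.
by apply: integrableS => //; apply: subset_itvr; rewrite bnd_simp.
Qed.

Lemma continuous_integrals_eq0 (h : R -> R) : continuous h ->
  (forall a b, a <= b -> \int[leb]_(y in `]a, b]) h y = 0) -> forall y, h y = 0.
Proof.
move=> ch h0 y.
wlog hy : h ch h0 / 0 < h y.
  move=> H; apply/eqP; rewrite eq_le !leNgt; apply/andP; split; apply/negP => hy.
    by have h00 := H h ch h0 hy; rewrite h00 ltxx in hy.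
  have : - h y = 0.
    apply: (H (fun x => - h x)); last by rewrite oppr_gt0.
      by move=> x; apply: cvgN; exact: ch.
    move=> a b ab; rewrite -[RHS]oppr0 -(h0 a b ab) -mulN1r -RintegralZl//.
      by apply: eq_Rintegral => x _; rewrite mulN1r.
    exact: integrable_itv_oc_continuous.
  by move=> /eqP; rewrite oppr_eq0 => /eqP hy0; move: hy; rewrite hy0 ltxx.
have c0 : h y / 2 < h y by lra.
have /nbhs_ballP[e /= e0 he] : \forall x \near y, h y / 2 < h x.
  exact: (cvgr_gt (h y) (ch y)).
have ye : y <= y + e / 2 by lra.
have := h0 _ _ ye.
suff : h y / 2 * (e / 2) <= \int[leb]_(x in `]y, (y + e / 2)]) h x.
  move=> + h00; rewrite h00 leNgt => /negP[].
  by rewrite mulr_gt0// divr_gt0.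
have -> : h y / 2 * (e / 2) = \int[leb]_(x in `]y, (y + e / 2)]) (cst (h y / 2) x).
  rewrite Rintegral_cst//= lebesgue_measure_itv/= lte_fin ltrDl divr_gt0//.
  by rewrite -EFinB/= addrAC subrr add0r.
apply: le_Rintegral => //.
- by apply: (@integrable_itv_oc_bounded _ _ `|h y / 2|).
- exact: integrable_itv_oc_continuous.
- move=> x; rewrite /= in_itv/= => /andP[yx xe]; apply/ltW/he.
  rewrite /ball/= ltr_distlC; apply/andP; split; lra.
Qed.

End localisation.

(** * The almost everywhere limit of the transforms is a transform *)

Section identification.
Context {R : realType}.
Local Notation leb := (@lebesgue_measure R).

Lemma countable_ae (D : set R) : countable D -> {ae leb, forall x, ~ D x}.
Proof.
move=> cD; exists D; split.
- exact: countable_measurable.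
- exact: countable_lebesgue_measure0.
- by move=> x /=; exact: contrapT.
Qed.

Lemma ae_reflect (D : set R) (b : R) : countable D -> {ae leb, forall u, ~ D (b - u)}.
Proof.
move=> cD; have := countable_ae (sub_countable (card_image_le (fun x => b - x) D) cD).
apply: (@filterS _ _ (ae_filter_ringOfSetsType leb)) => u nDu Dbu; apply: nDu.
by exists (b - u) => //; rewrite subKr.
Qed.

(** The phase y = 0 gives K1 = 0. Only countably many phases may be used at the
    same time; y = 1 / (n + 1) suffices, since for t <> 0 and n large t y lies in
    ]-1, 1[ without 0, where sin does not vanish. *)
Lemma trig_combination_ae_eq0 (K1 K2 : R -> R) :
  (forall y, {ae leb, forall t, K1 t * cos (t * y) + K2 t * sin (t * y) = 0}) ->
  {ae leb, forall t, K1 t = 0 /\ K2 t = 0}.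
Proof.
move=> K0; have h0 := K0 0.
have hn : {ae leb, forall t, forall n : nat,
    K1 t * cos (t * n.+1%:R^-1) + K2 t * sin (t * n.+1%:R^-1) = 0}.
  by apply: ae_foralln => n; exact: K0.
have n0 : {ae leb, forall t, ~ [set 0] t} by apply: countable_ae; exact: countable1.
apply: (@filterS3 _ _ (ae_filter_ringOfSetsType leb) _ _ _ _ _ h0 hn n0) => t.
rewrite mulr0 cos0 sin0 mulr1 mulr0 addr0 => K10 Kn t0; split => //.
have {}t0 : t != 0 by apply/eqP.
pose n := Num.truncn `|t|.
have tn : `|t * n.+1%:R^-1| < 1.
  by rewrite normrM normfV normr_nat ltr_pdivrMr// mul1r truncnS_gt.
have := Kn n; rewrite K10 mul0r add0r => /eqP; rewrite mulf_eq0 => /orP[/eqP//|/eqP].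
have sin_pos x : 0 < x -> x < 1 -> 0 < sin x :> R.
  move=> x0 x1; apply: sin_gt0_pi; rewrite ?x0//= (lt_trans x1)//.
  by have := pi_ge2 R; lra.
have tn0 : t * n.+1%:R^-1 != 0 by rewrite mulf_neq0// invr_eq0 pnatr_eq0.
move: tn tn0; set x := t * _ => x1 x0.
have [xp|xn] := ltP 0 x.
  by move=> sx0; have := sin_pos x xp; rewrite sx0 ltxx => /(_ (le_lt_trans (ler_norm _) x1)).
have xn' : 0 < - x by rewrite oppr_gt0 lt_neqAle x0.
move=> sx0; have := sin_pos (- x) xn'; rewrite sinN sx0 oppr0 ltxx.
by rewrite -normrN in x1; move=> /(_ (le_lt_trans (ler_norm _) x1)).
Qed.

Section limit.
Variables (G_ : nat -> R -> R) (G : R -> R) (M : R) (C S : R -> R) (D : set R).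
Hypotheses (G_V : forall n, class_V (G_ n)) (GV : class_V G).
Hypothesis G_M : forall n, fine (total_variationR (G_ n)) <= M.
Hypotheses (mC : measurable_fun setT C) (mS : measurable_fun setT S).
Hypothesis cosTC : {ae leb, forall t, cosT (G_ n) t @[n --> \oo] --> C t}.
Hypothesis sinTS : {ae leb, forall t, sinT (G_ n) t @[n --> \oo] --> S t}.
Hypotheses (CM : forall t, `|C t| <= M *+ 3) (SM : forall t, `|S t| <= M *+ 3).
Hypothesis cD : countable D.
Hypothesis G_G : forall a b, ~ D a -> ~ D b ->
  G_ n b - G_ n a @[n --> \oo] --> G b - G a.

Let cosM n t : `|cosT (G_ n) t| <= M *+ 3.
Proof. by rewrite (le_trans (normr_cosT_le (G_V n) t))// ler_wMn2r. Qed.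

Let sinM n t : `|sinT (G_ n) t| <= M *+ 3.
Proof. by rewrite (le_trans (normr_sinT_le (G_V n) t))// ler_wMn2r. Qed.

Let cvg_tent_avg s d y : 0 < d ->
  tent_avg s d (cosT (G_ n)) (sinT (G_ n)) y @[n --> \oo] --> tent_avg s d C S y.
Proof.
move=> d0; rewrite /tent_avg.
have mtrig (A B : R -> R) : measurable_fun setT A -> measurable_fun setT B ->
    measurable_fun setT
      (fun t : R => tent s d t * (A t * cos (t * y) + B t * sin (t * y))).
  move=> mA mB; apply: measurable_funM; first exact: measurable_tent.
  apply: measurable_funD; apply: measurable_funM => //; apply: measurable_trig_comp.
    exact: continuous_cos.
  exact: continuous_sin.
apply: (@Rintegral_dominated_cvg _ _ _ leb setT
  (fun n t => tent s d t * (cosT (G_ n) t * cos (t * y) + sinT (G_ n) t * sin (t * y)))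
  (fun t => tent s d t * (C t * cos (t * y) + S t * sin (t * y)))
  (fun t => M *+ 6 * tent s d t)) => //.
- move=> n; apply: mtrig; [exact: measurable_cosT|exact: measurable_sinT].
- exact: mtrig.
- apply: (@filterS2 _ _ (ae_filter_ringOfSetsType leb) _ _ _ _ cosTC sinTS) => t Ct St _.
  apply: cvgM; first exact: cvg_cst.
  by apply: cvgD; apply: cvgM => //; exact: cvg_cst.
- exact: (integrableZl measurableT (M *+ 6) (integrable_tent s d0)).
- move=> n t _; rewrite normrM (ger0_norm (tent_ge0 s d t)) mulrC.
  rewrite ler_wpM2r ?tent_ge0// (le_trans (ler_normD _ _))// !normrM.
  rewrite (_ : 6%N = (3 + 3)%N)// mulrnDr.
  apply: lerD; (rewrite -[leRHS]mulr1; apply: ler_pM) => //.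
    exact: normr_cos_le1.
  exact: normr_sin_le1.
Qed.

Let integral_tent_avg_limit s d a b : 0 < d -> a <= b ->
  \int[leb]_(y in `]a, b]) tent_avg s d C S y =
  \int[leb]_(y in `]a, b]) tent_avg s d (cosT G) (sinT G) y.
Proof.
move=> d0 ab.
have lim1 : \int[leb]_(y in `]a, b]) tent_avg s d (cosT (G_ n)) (sinT (G_ n)) y
    @[n --> \oo] --> \int[leb]_(y in `]a, b]) tent_avg s d C S y.
  apply: (@Rintegral_dominated_cvg _ _ _ leb `]a, b]%classic
    (fun n => tent_avg s d (cosT (G_ n)) (sinT (G_ n))) (tent_avg s d C S)
    (fun=> M *+ 3 *+ 2 * \int[leb]_t tent s d t)) => //.
  - move=> n; apply: measurable_funTS.
    exact: (measurable_tent_avg s d0 (measurable_cosT (G_V n)) (measurable_sinT (G_V n))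
      (cosM n) (sinM n)).
  - by apply: measurable_funTS; exact: (measurable_tent_avg s d0 mC mS CM SM).
  - by apply: aeW => y _; exact: cvg_tent_avg.
  - apply: (@integrable_itv_oc_bounded _ _
      `|M *+ 3 *+ 2 * \int[leb]_t tent s d t|) => //.
  - move=> n y _; exact: (normr_tent_avg_le s d0 (measurable_cosT (G_V n))
      (measurable_sinT (G_V n)) (cosM n) (sinM n)).
have lim2 : \int[leb]_u (tentF s d u * (G_ n (b - u) - G_ n (a - u)))
    @[n --> \oo] --> \int[leb]_u (tentF s d u * (G (b - u) - G (a - u))).
  apply: (@Rintegral_dominated_cvg _ _ _ leb setT
    (fun n u => tentF s d u * (G_ n (b - u) - G_ n (a - u)))
    (fun u => tentF s d u * (G (b - u) - G (a - u)))
    (fun u => M * `|tentF s d u|)) => //.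
  - move=> n; apply: measurable_funM; first exact: measurable_tentF.
    exact: measurable_increment.
  - apply: measurable_funM; first exact: measurable_tentF.
    exact: measurable_increment.
  - apply: (@filterS2 _ _ (ae_filter_ringOfSetsType leb) _ _ _ _
      (ae_reflect a cD) (ae_reflect b cD)) => u Da Db _.
    by apply: cvgM; [exact: cvg_cst|exact: G_G].
  - exact: (integrableZl measurableT M (integrable_norm (integrable_tentF s d0))).
  - move=> n u _; rewrite normrM mulrC ler_wpM2r//.
    exact: le_trans (normr_increment_le (G_V n) _ _) (G_M n).
rewrite (integral_tent_avg_fourier GV)//; apply: cvg_unique lim1 _ => //.
apply: cvg_trans lim2; apply: near_eq_cvg; apply: nearW => n.
by rewrite (integral_tent_avg_fourier (G_V n)).
Qed.

(** C and S have the same tent averages as the transform of G, for all y because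
    the averages are continuous in y; the differences C - cosT G and S - sinT G
    therefore have zero tent averages for every phase. *)
Lemma transform_limit_ae : {ae leb, forall t, C t = cosT G t /\ S t = sinT G t}.
Proof.
pose M' := M *+ 3 + fine (total_variationR G) *+ 3.
have M0 : 0 <= M *+ 3 := le_trans (normr_ge0 _) (CM 0).
have V0 : 0 <= fine (total_variationR G) *+ 3.
  exact: le_trans (normr_ge0 _) (normr_cosT_le GV 0).
have CM' t : `|C t| <= M' by rewrite (le_trans (CM t))// lerDl.
have SM' t : `|S t| <= M' by rewrite (le_trans (SM t))// lerDl.
have cM' t : `|cosT G t| <= M' by rewrite (le_trans (normr_cosT_le GV t))// lerDr.
have sM' t : `|sinT G t| <= M' by rewrite (le_trans (normr_sinT_le GV t))// lerDr.
have mcG := measurable_cosT GV; have msG := measurable_sinT GV.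
have avg0 s d y : 0 < d ->
    tent_avg s d C S y - tent_avg s d (cosT G) (sinT G) y = 0.
  move=> d0; pose h x := tent_avg s d C S x - tent_avg s d (cosT G) (sinT G) x.
  have c1 := continuous_tent_avg (s := s) d0 mC mS CM' SM'.
  have c2 := continuous_tent_avg (s := s) d0 mcG msG cM' sM'.
  apply: (continuous_integrals_eq0 (h := h)) => [x|a b ab].
    by apply: cvgB; [exact: c1|exact: c2].
  rewrite RintegralB//; [|exact: integrable_itv_oc_continuous..].
  by rewrite integral_tent_avg_limit// subrr.
have suff0 : {ae leb, forall t, C t - cosT G t = 0 /\ S t - sinT G t = 0}.
  apply: trig_combination_ae_eq0 => y; apply: (@ae_eq0_tent _ _ (M' *+ 4)).
  - apply: measurable_funD; apply: measurable_funM.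
    + exact: measurable_funB.
    + by apply: measurable_trig_comp; exact: continuous_cos.
    + exact: measurable_funB.
    + by apply: measurable_trig_comp; exact: continuous_sin.
  - move=> t; rewrite (_ : 4%N = (2 + 2)%N)// mulrnDr (le_trans (ler_normD _ _))// !normrM.
    apply: lerD; rewrite -[leRHS]mulr1 ler_pM ?normr_cos_le1 ?normr_sin_le1//.
      by rewrite (le_trans (ler_normB _ _))// mulr2n lerD.
    by rewrite (le_trans (ler_normB _ _))// mulr2n lerD.
  - by move=> s d d0; rewrite -(avg0 s d y d0) -(@tent_avgB _ _ _ M').
apply: (@filterS _ _ (ae_filter_ringOfSetsType leb) _ _ _ suff0) => t [/eqP + /eqP].
by rewrite !subr_eq0 => /eqP -> /eqP ->.
Qed.

End limit.
End identification.

(** * A function of the class V is determined by its transform *)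

Lemma countableU (T : Type) (A B : set T) :
  countable A -> countable B -> countable (A `|` B).
Proof.
move=> cA cB; rewrite -bigcup2E; apply: bigcup_countable => // -[|[|n]] _ //=.
Qed.

Section uniqueness.
Context {R : realType}.
Local Notation leb := (@lebesgue_measure R).
Implicit Types (G H : R -> R).

Lemma ae_exists_itv (P : R -> Prop) (a b : R) : {ae leb, forall x, P x} -> a < b ->
  exists x, [/\ a < x, x < b & P x].
Proof.
move=> [A [mA A0 PA]] ab; apply: contrapT => nex.
have : (leb `]a, b[%classic <= leb A)%E.
  apply: le_measure; rewrite ?inE// => x /=; rewrite in_itv/= => /andP[ax xb].
  by apply: PA => Px; apply: nex; exists x.
rewrite [X in (_ <= X)%E]A0 /= lebesgue_measure_itv/= lte_fin ab -EFinB lee_fin leNgt.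
by rewrite subr_gt0 ab.
Qed.

(** A set of full measure is dense, so f and g share their limit at x along it. *)
Lemma ae_eq_at_continuity (T : topologicalType) (f g : R -> T) (x : R) :
  hausdorff_space T -> {ae leb, forall y, f y = g y} ->
  {for x, continuous f} -> {for x, continuous g} -> f x = g x.
Proof.
move=> hT fg cf cg; pose F := within [set y | f y = g y] (nbhs x).
have FF : ProperFilter F.
  apply: within_nbhs_proper => A /nbhs_ballP[e /= e0 eA].
  have xe : x < x + e by rewrite ltrDl.
  have [y [xy ye fgy]] := ae_exists_itv fg xe.
  exists y; split => //; apply: eA; rewrite /ball/= ltr_distlC; lra.
have fF : f y @[y --> F] --> f x by apply: cvg_within_filter; exact: cf.
have gF : g y @[y --> F] --> g x by apply: cvg_within_filter; exact: cg.
apply: (cvg_unique hT fF); apply: cvg_trans gF; apply: near_eq_cvg.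
by rewrite /F near_withinE; apply: nearW => y /= ->.
Qed.

Lemma continuous_ae_eq (f g : R -> R) : continuous f -> continuous g ->
  {ae leb, forall x, f x = g x} -> f = g.
Proof.
move=> cf cg fg; apply/funext => x.
exact: (ae_eq_at_continuity (@Rhausdorff R) fg (cf x) (cg x)).
Qed.

(** By right continuity and monotony, both one-sided limits exist and a point of
    discontinuity is a jump. *)
Lemma cumulative_discontinuities_countable (F : cumulative R R) :
  countable [set x | ~ {for x, continuous F}].
Proof.
have ndF := cumulative_is_nondecreasing F.
apply: (@sub_countable _ _ _
  (\bigcup_n [set x : R | (x \in `](- n%:R), n%:R[) /\ discontinuity F x])); last first.
  by apply: bigcup_countable => // n _; apply: discontinuity_countable => x y _ _; exact: ndF.
apply: subset_card_le => x nFx.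
pose n := (Num.truncn `|x|).+1.
have xn : `|x| < n%:R by exact: truncnS_gt.
exists n => //=; split; first by rewrite in_itv/= -ltr_norml.
have cr : F y @[y --> x^'+] --> F x by exact: cumulative_is_right_continuous.
have cl : cvg (F y @[y --> x^'-]).
  apply: nondecreasing_at_left_is_cvgr.
    by apply: nearW => y z t _ _; exact: ndF.
  apply: nearW => y; exists (F x) => _ [z + <-].
  by rewrite /= in_itv/= => /andP[_ /ltW]; exact: ndF.
split => //; first by apply/cvg_ex; exists (F x).
apply/eqP => lE; apply: nFx; apply/left_right_continuousP; split => //.
by rewrite -(cvg_lim _ cr)// -lE.
Qed.

Lemma class_V_discontinuities_countable G : class_V G ->
  countable [set x | ~ {for x, continuous G}].
Proof.
move=> [GVoo Grc _]; have [F [N [GFN _ _]]] := variation_function GVoo Grc.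
apply: (@sub_countable _ _ _ ([set x | ~ {for x, continuous F}] `|`
    [set x | ~ {for x, continuous N}])); last first.
  by apply: countableU; exact: cumulative_discontinuities_countable.
apply: subset_card_le => x nGx; apply: contrapT => /not_orP[/contrapT cF /contrapT cN].
apply: nGx; rewrite (funext GFN).
by apply: cvgB; [exact: cF|exact: cN].
Qed.

(** The closed forms agree off 0, and both sides are continuous. *)
Lemma fejer_scaling (d u : R) : 0 < d -> tentF 0 d u = d * tentF 0 1 (d * u).
Proof.
move=> d0; suff E : tentF 0 d = (fun u => d * tentF 0 1 (d * u)) by exact: (congr1 (fun f => f u) E).
apply: continuous_ae_eq.
- exact: continuous_tentF.
- move=> v; apply: cvgM; first exact: cvg_cst.
  rewrite (_ : (fun v => _) = fun v => tentF 0 1 (v * d)).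
    by rewrite mulrC; apply: continuous_comp_mulr; exact: continuous_tentF.
  by apply/funext => z; rewrite mulrC.
- have : {ae leb, forall v : R, ~ [set 0] v} by apply: countable_ae; exact: countable1.
  apply: (@filterS _ _ (ae_filter_ringOfSetsType leb)) => v /eqP v0.
  have dv0 : d * v != 0 by rewrite mulf_neq0// gt_eqF.
  rewrite !tentFE// !mul0r cos0 mul1r.
  by field; rewrite v0 gt_eqF.
Qed.

(** The kernel is nonnegative and, as cos decreases on [0, pi], bounded below on
    [1, 2]. *)
Lemma fejer_integral_gt0 : 0 < \int[leb]_u tentF 0 1 u.
Proof.
pose c : R := (1 - cos 1) / 2.
have c0 : 0 < c.
  rewrite divr_gt0// subr_gt0 -[ltRHS]cos0 ltr_cos ?in_itv/= ?lexx ?pi_ge0//.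
  by have := pi_ge2 R; lra.
apply: (@lt_le_trans _ _ (\int[leb]_u (c * \1_(`[1, 2]) u))).
  rewrite RintegralZl//; last exact: integrable_indic_itv.
  rewrite /Rintegral integral_indic// setIT /= lebesgue_measure_itv/= lte_fin ltr1n.
  by rewrite -EFinB/= mulr_gt0// subr_gt0 ltr1n.
apply: le_Rintegral => //.
- exact: (integrableZl measurableT c (integrable_indic_itv 1 2 true false)).
- exact: integrable_tentF.
- move=> u _; have [->|u0] := eqVneq u 0.
    rewrite indicE memNset ?mulr0; last by rewrite /= in_itv/= ler10.
    apply: Rintegral_ge0 => t _; rewrite mulr0 cos0 mulr1; exact: tent_ge0.
  rewrite tentFE// mul0r cos0 mulr1 !mul1r indicE.
  case: (boolP (u \in _)) => [|_]; last first.
    by rewrite mulr0 divr_ge0 ?sqr_ge0// mulr_ge0// subr_ge0 cos_le1.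
  rewrite inE/= in_itv/= => /andP[u1 u2].
  rewrite mulr1 ler_pdivlMr ?exprn_even_gt0// /c.
  have cu : cos u <= cos 1.
    move: u1; rewrite le_eqVlt => /predU1P[->//|u1].
    by rewrite ltW// ltr_cos// in_itv/=; have := pi_ge2 R; lra.
  have u4 : u ^+ 2 <= 4 by rewrite (_ : 4 = 2 ^+ 2); [rewrite ler_sqr// nnegrE; lra|ring].
  have c1 : 0 <= 1 - cos 1 :> R by rewrite subr_ge0 cos_le1.
  have h : (1 - cos 1) / 2 * u ^+ 2 <= (1 - cos 1) / 2 * 4.
    by rewrite ler_wpM2l// divr_ge0.
  lra.
Qed.

(** With W = G - H, the Fejer kernels, which concentrate at 0, show that W takes
    the same value at any two common continuity points of G and H. These points
    are dense, so the limit at -oo makes this value 0 and right continuity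
    extends it to the line. *)
Lemma class_V_unique G H : class_V G -> class_V H ->
  cosT G = cosT H -> sinT G = sinT H -> G = H.
Proof.
move=> GV HV cGH sGH.
pose W x := G x - H x.
pose D := [set x | ~ {for x, continuous G}] `|` [set x | ~ {for x, continuous H}].
have cD : countable D.
  by apply: countableU; exact: class_V_discontinuities_countable.
have cW x : ~ D x -> {for x, continuous W}.
  move=> /not_orP[/contrapT cG /contrapT cH].
  by apply: cvgB; [exact: cG|exact: cH].
have W0 a b : a <= b -> ~ D a -> ~ D b -> W a = W b.
  move=> ab Da Db; pose w u := W (b - u) - W (a - u).
  have mw : measurable_fun setT w.
    rewrite (_ : w = fun u => (G (b - u) - G (a - u)) - (H (b - u) - H (a - u))).
      by apply: measurable_funB; exact: measurable_increment.
    by apply/funext => u; rewrite /w /W; ring.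
  pose V := fine (total_variationR G) + fine (total_variationR H).
  have wV u : `|w u| <= V.
    rewrite (_ : w u = (G (b - u) - G (a - u)) - (H (b - u) - H (a - u))); last first.
      by rewrite /w /W; ring.
    by rewrite (le_trans (ler_normB _ _))// lerD// normr_increment_le.
  have cw : w u @[u --> (0 : R)] --> w 0.
    have shift c : ~ D c -> W (c - u) @[u --> (0 : R)] --> W (c - 0).
      move=> Dc; have hc : c - u @[u --> (0 : R)] --> c - 0.
        by apply: cvgB; [exact: cvg_cst|exact: cvg_id].
      by rewrite subr0 in hc *; exact: (cvg_comp _ _ hc (cW _ Dc)).
    by apply: cvgB; exact: shift.
  have ikw d : 0 < d -> leb.-integrable setT (EFin \o (fun u => tentF 0 d u * w u)).
    move=> d0; apply: (le_integrable measurableT _ _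
      (integrableZl measurableT V (integrable_norm (integrable_tentF 0 d0)))).
      by apply/measurable_EFinP; apply: measurable_funM => //; exact: measurable_tentF.
    move=> u _ /=; rewrite lee_fin normrM mulrC (le_trans _ (ler_norm _))//.
    by rewrite ler_wpM2r.
  have tentF_w0 d : 0 < d -> \int[leb]_u (tentF 0 d u * w u) = 0.
    move=> d0.
    have iI E : class_V E -> leb.-integrable setT
        (EFin \o (fun u => tentF 0 d u * (E (b - u) - E (a - u)))).
      move=> EV; apply: (le_integrable measurableT _ _ (integrableZl measurableT
        (fine (total_variationR E)) (integrable_norm (integrable_tentF 0 d0)))).
        apply/measurable_EFinP; apply: measurable_funM; first exact: measurable_tentF.
        exact: measurable_increment.
      move=> u _ /=; rewrite lee_fin normrM mulrC (le_trans _ (ler_norm _))//.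
      by rewrite ler_wpM2r// normr_increment_le.
    transitivity (\int[leb]_u (tentF 0 d u * (G (b - u) - G (a - u))) -
                  \int[leb]_u (tentF 0 d u * (H (b - u) - H (a - u)))).
      rewrite -RintegralB//; [|exact: iI|exact: iI].
      by apply: eq_Rintegral => u _; rewrite /w /W; ring.
    rewrite -(integral_tent_avg_fourier GV)// -(integral_tent_avg_fourier HV)//.
    by rewrite cGH sGH subrr.
  have ik1 : leb.-integrable setT (EFin \o tentF 0 (1 : R)) by exact: integrable_tentF.
  have mK : measurable_fun setT (tentF 0 (1 : R)) by exact: measurable_tentF.
  have mws (n : nat) : measurable_fun setT (fun v : R => w (v / n.+1%:R)).
    by apply: (measurableT_comp mw); apply: measurable_funM.
  (* v = (n + 1) u turns the Fejer kernel of parameter n + 1 into a fixed one,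
     so that dominated convergence applies *)
  have scaled0 (n : nat) : \int[leb]_v (tentF 0 1 v * w (v / n.+1%:R)) = 0.
    have n0 : 0 < n.+1%:R :> R by rewrite ltr0n.
    rewrite (@Rintegral_affine _ n.+1%:R 0 (fun v => tentF 0 1 v * w (v / n.+1%:R)))//; last first.
      apply: (le_integrable measurableT _ _
        (integrableZl measurableT V (integrable_norm ik1))).
        by apply/measurable_EFinP; exact: (measurable_funM mK (mws n)).
      move=> v _ /=; rewrite lee_fin normrM mulrC (le_trans _ (ler_norm _))//.
      by rewrite ler_wpM2r.
    rewrite (_ : \int[leb]_u _ = \int[leb]_u (n.+1%:R^-1 * (tentF 0 n.+1%:R u * w u))).
      by rewrite RintegralZl ?tentF_w0 ?mulr0//; exact: ikw.
    apply: eq_Rintegral => u _; rewrite addr0 (fejer_scaling u n0) mulrA mulrA.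
    rewrite mulVf ?gt_eqF// mul1r; congr (_ * w _).
    by rewrite mulrAC mulfV ?gt_eqF// mul1r.
  have lim0 : \int[leb]_v (tentF 0 1 v * w (v / n.+1%:R)) @[n --> \oo] -->
      \int[leb]_v (tentF 0 1 v * w 0).
    apply: (@Rintegral_dominated_cvg _ _ _ leb setT
      (fun n v => tentF 0 1 v * w (v / n.+1%:R)) (fun v => tentF 0 1 v * w 0)
      (fun v => V * `|tentF 0 1 v|)) => //.
    - by move=> n; exact: (measurable_funM mK (mws n)).
    - by apply: measurable_funM.
    - apply: aeW => v _; apply: cvgM; first exact: cvg_cst.
      have hv : v / n.+1%:R @[n --> \oo] --> v * 0.
        by apply: cvgM; [exact: cvg_cst|exact: cvg_harmonic].
      by rewrite mulr0 in hv; exact: (cvg_comp _ _ hv cw).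
    - exact: (integrableZl measurableT V (integrable_norm ik1)).
    - by move=> n v _; rewrite normrM mulrC ler_wpM2r.
  have : \int[leb]_v (tentF 0 1 v * w 0) = 0.
    apply: cvg_unique lim0 _ => //.
    by rewrite (_ : (fun n => _) = cst 0); [exact: cvg_cst|apply/funext => n; exact: scaled0].
  rewrite RintegralZr// => /eqP; rewrite mulf_eq0 gt_eqF ?fejer_integral_gt0//=.
  by rewrite /w !subr0 subr_eq0 => /eqP.
have Wc a b : ~ D a -> ~ D b -> W a = W b.
  by have [ab|/ltW ba] := leP a b => Da Db; [exact: W0|apply/esym/W0].
have WD x : ~ D x -> W x = 0.
  move=> Dx; apply/eqP; rewrite -normr_le0 leNgt; apply/negP => Wx.
  have [_ _ GNy] := GV; have [_ _ HNy] := HV.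
  have WNy : W y @[y --> -oo] --> (0 : R) by rewrite -[0]subr0; exact: cvgB.
  have [M [_ hM]] := cvgr0_norm_lt _ WNy _ Wx.
  have [y [_ yM Dy]] : exists y, [/\ M - 1 < y, y < M & ~ D y].
    by apply: (ae_exists_itv (countable_ae cD)); rewrite ltrBlDr ltrDl.
  by have := hM y yM; rewrite (Wc y x)// ltxx.
apply/funext => x; apply/eqP; rewrite -subr_eq0 -normr_le0 leNgt; apply/negP => Wx.
have [_ Grc _] := GV; have [_ Hrc _] := HV.
have Wr : `|W y| @[y --> x^'+] --> `|W x|.
  by apply: cvg_norm; apply: cvgB; [exact: Grc|exact: Hrc].
have : \forall y \near x^'+, 0 < `|W y| by exact: (cvgr_gt _ Wr).
move=> [e /= e0 he].
have xe : x < x + e by rewrite ltrDl.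
have [y [xy ye Dy]] := ae_exists_itv (countable_ae cD) xe.
have : 0 < `|W y| by apply: he => //; rewrite /ball/= ltr_distlC; lra.
by rewrite WD// normr0 ltxx.
Qed.

End uniqueness.

(** * Helly's selection principle *)

Section helly.
Context {R : realType}.

(** Tychonoff's theorem gives a cluster point p of the sequence in the compact
    product of the intervals [-M, M]. Since I is countable, p is approached along
    a subsequence: the k-th term is chosen within 1/(k + 1) of p at the k first
    indices, a neighbourhood of p as it constrains finitely many coordinates. *)
Lemma pointwise_subsequence (I : countType) (u : nat -> I -> R) (M : R) :
  (forall n i, `|u n i| <= M) ->
  exists psi : nat -> nat, {homo psi : m n / (m < n)%N} /\
  exists p : I -> R, forall i, u (psi k) i @[k --> \oo] --> p i.
Proof.
move=> uM.
have cK := @tychonoff I (fun=> R) (fun=> `[- M, M]%classic)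
  (fun=> @segment_compact R (- M) M).
have FK : (u @ \oo) [set f : forall i : I, R | forall i, `[- M, M]%classic (f i)].
  by exists 0%N => // n _ i /=; rewrite in_itv/= -ler_norml.
have [p [_ clp]] := cK (u @ \oo) _ FK.
have nb1 (i : I) (e : R) : 0 < e -> nbhs p [set f : I -> R | ball (p i) e (f i)].
  move=> e0; have := @proj_continuous I (fun=> R) i p.
  by apply; exact: nbhsx_ballx.
have step (k m : nat) : exists n, (m < n)%N /\
    forall i, (pickle i < k)%N -> `|u n i - p i| < k.+1%:R^-1.
  have nbp : nbhs p [set f : I -> R | forall j : 'I_k,
      forall i : I, unpickle j = Some i -> ball (p i) k.+1%:R^-1 (f i)].
    apply: (@filter_forall _ _ (fun (j : 'I_k) (f : I -> R) =>
      forall i : I, unpickle j = Some i -> ball (p i) k.+1%:R^-1 (f i)) (nbhs p)).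
    move=> j; case: (unpickle j) => [i|]; last first.
      by apply: (@filterE _ (nbhs p) (nbhs_filter p)).
    apply: (@filterS _ (nbhs p) (nbhs_filter p) _ _ _ (nb1 i k.+1%:R^-1 _)).
      by move=> f fi _ [<-].
    by rewrite invr_gt0.
  have Fm : (u @ \oo) (u @` [set n | (m < n)%N]).
    by exists m.+1 => // n /= mn; exists n.
  have [_ [[n mn <-] nb]] := clp _ _ Fm nbp.
  exists n; split => // i ik.
  have := nb (Ordinal ik) i; rewrite /= pickleK => /(_ erefl).
  by rewrite /ball/= distrC.
have [next nextP] : exists next : nat -> nat -> nat, forall k m, (m < next k m)%N /\
    forall i, (pickle i < k)%N -> `|u (next k m) i - p i| < k.+1%:R^-1.
  exists (fun k m => sval (cid (step k m))) => k m.
  exact: svalP (cid (step k m)).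
pose psi := fix psi k := if k is k'.+1 then next k (psi k') else next 0%N 0%N.
have psiP k i : (pickle i < k)%N -> `|u (psi k) i - p i| < k.+1%:R^-1.
  by case: k => // k; have [_] := nextP k.+1 (psi k); exact.
exists psi; split.
  apply: homo_ltn => [y x z|k]; first exact: ltn_trans.
  by have [] := nextP k.+1 (psi k).
exists p => i; apply/cvgrPdist_lt => e e0.
have /cvgrPdist_lt/(_ e e0) := @cvg_harmonic R.
move=> [N _ hN]; exists (maxn N (pickle i).+1) => // k /=.
rewrite geq_max => /andP[Nk ik]; rewrite distrC (lt_trans (psiP _ _ ik))//.
have := hN k Nk; rewrite /harmonic/= sub0r normrN ger0_norm//.
Qed.

(** Taking the infimum of p over the rationals to the right of x makes P
    nondecreasing and right-continuous at once. At a continuity point x of P,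
    monotony traps f_n(x) between its values at two rationals around x, whose
    limits are within e of P(x). *)
Lemma cumulative_of_rational_limit (f_ : nat -> R -> R) (M : R) (p : rat -> R) :
  (forall n, nondecreasing (f_ n)) -> (forall n x, `|f_ n x| <= M) ->
  (forall q, f_ n (ratr q) @[n --> \oo] --> p q) ->
  exists P : cumulative R R, (forall x, `|P x| <= M) /\
    forall x, {for x, continuous P} -> f_ n x @[n --> \oo] --> P x.
Proof.
move=> nd fM fp.
pose A (x : R) := [set p q | q in [set q : rat | x < ratr q]].
have pM q : `|p q| <= M.
  have : `|f_ n (ratr q)| @[n --> \oo] --> `|p q| by apply: cvg_norm; exact: fp.
  by move/cvgr_to_le; apply; exact: nearW.
have A0 x : A x !=set0.
  have [q] : exists q : rat, ratr q \in `]x, (x + 1)[.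
    by apply: rat_in_itvoo; rewrite ltrDl.
  by rewrite in_itv/= => /andP[xq _]; exists (p q); exists q.
have Alb x : lbound (A x) (- M).
  by move=> _ [q _ <-]; have := pM q; rewrite ler_norml => /andP[].
have Ainf x : has_inf (A x) by split => //; exists (- M); exact: Alb.
pose P x := inf (A x).
have Ple x q : x < ratr q -> P x <= p q.
  by move=> xq; apply: ge_inf; [exact: (Ainf x).2|exists q].
have PM x : `|P x| <= M.
  rewrite ler_norml; apply/andP; split; first exact: lb_le_inf.
  have [_ [q xq _]] := A0 x; rewrite (le_trans (Ple _ _ xq))//.
  by rewrite (le_trans _ (pM q))// ler_norm.
have Pnd : nondecreasing P.
  move=> x y xy; apply: lb_le_inf => // _ [q yq <-].
  by apply: Ple; exact: le_lt_trans yq.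
have Padh x e : 0 < e -> exists q : rat, x < ratr q /\ p q < P x + e.
  by move=> e0; have [_ [q xq <-] pq] := inf_adherent e0 (Ainf x); exists q; split.
have Prc : right_continuous P.
  move=> x; apply/cvgrPdist_lt => e e0; have [q [xq pq]] := Padh x e e0.
  near=> y; have xy : x <= y by [].
  have yq : y < ratr q by near: y; exact: nbhs_right_lt.
  rewrite ler0_norm ?subr_le0 ?Pnd// opprB ltrBlDl.
  exact: le_lt_trans (Ple _ _ yq) pq.
pose cP : cumulative R R := HB.pack P (isCumulative.Build R _ R P Pnd Prc).
exists cP; split => // x cx; apply/cvgrPdist_lt => e e0.
have [q2 [xq2 pq2]] := Padh x e e0.
have [q1 [q1x pq1]] : exists q1 : rat, ratr q1 < x /\ P x - e < p q1.
  have : \forall y \near x, P x - e < P y.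
    have lt : P x - e < P x by rewrite ltrBlDr ltrDl.
    exact: (cvgr_gt (P x) cx _ lt).
  move=> /nbhs_ballP[d /= d0 hd].
  have [q] : exists q : rat, ratr q \in `](x - d / 2), x[.
    by apply: rat_in_itvoo; rewrite ltrBlDr ltrDl divr_gt0.
  rewrite in_itv/= => /andP[xq qx]; exists q; split => //.
  apply: lt_le_trans (Ple _ _ xq); apply: hd.
  by rewrite /ball/= opprB addrCA subrr addr0 gtr0_norm; lra.
have n1 : \forall n \near \oo, P x - e < f_ n (ratr q1) by exact: (cvgr_gt (p q1) (fp q1) _ pq1).
have n2 : \forall n \near \oo, f_ n (ratr q2) < P x + e by exact: (cvgr_lt (p q2) (fp q2) _ pq2).
near=> n; rewrite ltr_distlC.
apply/andP; split.
  by apply: (@lt_le_trans _ _ (f_ n (ratr q1))); [near: n|exact/nd/ltW].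
by apply: (@le_lt_trans _ _ (f_ n (ratr q2))); [exact/nd/ltW|near: n].
Unshelve. all: by end_near. Qed.

Lemma cvg_ninfty_cumulative (F : cumulative R R) (M : R) :
  (forall x, `|F x| <= M) -> cvg (F x @[x --> -oo]).
Proof.
move=> FM; apply/cvg_ex; exists (- sup (range (fun x => - F (- x)))).
apply/cvgNy_compNP.
have -> : F \o -%R = (fun x => - (fun x => - F (- x)) x).
  by apply/funext => x; rewrite opprK.
apply: cvgN; apply: nondecreasing_cvgr.
  by move=> x y xy; rewrite lerN2 cumulative_is_nondecreasing// lerN2.
exists M => _ [x _ <-]; rewrite (le_trans _ (FM (- x)))//.
by rewrite -normrN ler_norm.
Qed.

(** Both monotone parts are extracted at the same time by indexing over
    bool * rat. They are shifted to vanish at 0, so as to be bounded uniformly in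
    n, and the limit is shifted to vanish at -oo; increments are unaffected. *)
Lemma helly_class_V (G_ : nat -> R -> R) (M : R) : (forall n, class_V (G_ n)) ->
  (forall n, fine (total_variationR (G_ n)) <= M) ->
  exists psi : nat -> nat, {homo psi : m n / (m < n)%N} /\
  exists G : R -> R, [/\ right_continuous G, G x @[x --> -oo] --> (0 : R) &
    exists D : set R, countable D /\ forall a b, ~ D a -> ~ D b ->
      G_ (psi k) b - G_ (psi k) a @[k --> \oo] --> G b - G a].
Proof.
move=> G_V G_M.
have M0 : 0 <= M by rewrite (le_trans _ (G_M 0%N))// fine_ge0// total_variationR_ge0.
have dec n : exists FN : cumulative R R * cumulative R R,
    [/\ forall x, G_ n x = FN.1 x - FN.2 x,
        forall x, `|FN.1 x - FN.1 0| <= M *+ 2 & forall x, `|FN.2 x - FN.2 0| <= M *+ 2].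
  have [GVoo Grc _] := G_V n; have [F [N [GFN FV NV]]] := variation_function GVoo Grc.
  have bnd (H : cumulative R R) K : K <= M *+ 2 ->
      (forall a b, a <= b -> H b - H a <= K) -> forall x, `|H x - H 0| <= M *+ 2.
    move=> KM HK x; have [x0|/ltW x0] := leP 0 x.
      rewrite ger0_norm ?subr_ge0 ?cumulative_is_nondecreasing//.
      exact: le_trans (HK _ _ x0) KM.
    rewrite ler0_norm ?subr_le0 ?cumulative_is_nondecreasing// opprB.
    exact: le_trans (HK _ _ x0) KM.
  exists (F, N); split => //=.
    by apply: bnd FV; rewrite (le_trans (G_M n))// mulr2n lerDl.
  by apply: bnd NV; rewrite ler_wMn2r.
have [FN FNP] := choice dec.
pose f n x := (FN n).1 x - (FN n).1 0; pose h n x := (FN n).2 x - (FN n).2 0.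
have fM n x : `|f n x| <= M *+ 2 by case: (FNP n) => _ + _; exact.
have hM n x : `|h n x| <= M *+ 2 by case: (FNP n) => _ _; exact.
have fnd n : nondecreasing (f n).
  by move=> x y xy; rewrite lerB// cumulative_is_nondecreasing.
have hnd n : nondecreasing (h n).
  by move=> x y xy; rewrite lerB// cumulative_is_nondecreasing.
pose u n (i : bool * rat) := if i.1 then f n (ratr i.2) else h n (ratr i.2).
have uM n i : `|u n i| <= M *+ 2 by rewrite /u; case: ifP.
have [psi [psi_incr [p up]]] := pointwise_subsequence uM.
have [P [PM fP]] : exists P : cumulative R R, (forall x, `|P x| <= M *+ 2) /\
    forall x, {for x, continuous P} -> f (psi k) x @[k --> \oo] --> P x.
  apply: (cumulative_of_rational_limit (p := fun q => p (true, q))) => //.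
  by move=> q; exact: (up (true, q)).
have [Q [QM hQ]] : exists Q : cumulative R R, (forall x, `|Q x| <= M *+ 2) /\
    forall x, {for x, continuous Q} -> h (psi k) x @[k --> \oo] --> Q x.
  apply: (cumulative_of_rational_limit (p := fun q => p (false, q))) => //.
  by move=> q; exact: (up (false, q)).
pose lP := lim (P x @[x --> -oo]); pose lQ := lim (Q x @[x --> -oo]).
exists psi; split => //; exists (fun x => (P x - Q x) - (lP - lQ)); split.
- move=> x; apply: cvgB; last exact: cvg_cst.
  by apply: cvgB; exact: cumulative_is_right_continuous.
- rewrite -[0](subrr (lP - lQ)); apply: cvgB; last exact: cvg_cst.
  by apply: cvgB; apply: (cvg_ninfty_cumulative (M := M *+ 2)).
exists ([set x | ~ {for x, continuous P}] `|` [set x | ~ {for x, continuous Q}]); split.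
  by apply: countableU; exact: cumulative_discontinuities_countable.
move=> a b /not_orP[/contrapT aP /contrapT aQ] /not_orP[/contrapT bP /contrapT bQ].
rewrite (_ : _ - _ = (P b - Q b) - (P a - Q a)); last by ring.
have -> : (fun k => G_ (psi k) b - G_ (psi k) a) =
    (fun k => (f (psi k) b - h (psi k) b) - (f (psi k) a - h (psi k) a)).
  apply/funext => k; have [GE _ _] := FNP (psi k).
  by rewrite !GE /f /h; ring.
apply: cvgB; apply: cvgB.
- exact: fP.
- exact: hQ.
- exact: fP.
- exact: hQ.
Qed.

End helly.

(** * Lower semicontinuity of the total variation *)

Section variation_limit.
Context {R : realType}.
Local Notation leb := (@lebesgue_measure R).

Lemma cvg_sumr (T : Type) (F : set_system T) (FF : Filter F) (r : seq nat)
    (f : nat -> T -> R) (l : nat -> R) :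
  (forall i, f i x @[x --> F] --> l i) ->
  \sum_(i <- r) f i x @[x --> F] --> \sum_(i <- r) l i.
Proof.
move=> fl; elim: r => [|i r IH].
  by rewrite big_nil; under eq_fun do rewrite big_nil; exact: cvg_cst.
by rewrite big_cons; under eq_fun do rewrite big_cons; exact: cvgD.
Qed.

Lemma right_continuous_shift (G : R -> R) (x : R) : right_continuous G ->
  G (x + h) @[h --> (0 : R)^'+] --> G x.
Proof.
move=> Grc; have sh : x + h @[h --> (0 : R)^'+] --> x^'+.
  move=> U [e /= e0 eU]; exists e => //= h h0e h0; apply: eU; last by rewrite ltrDl.
  by move: h0e; rewrite /ball/= sub0r opprD addrA subrr sub0r.
exact: (cvg_comp _ _ sh (Grc x)).
Qed.

(** Each partition is translated by a small h > 0 such that its points avoid D: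
    there the increments converge, so the sum over the translated partition is at
    most B, and h -> 0+ recovers the original sum by right continuity. Almost
    every h is suitable, D being countable. *)
Lemma total_variationR_limit (H_ : nat -> R -> R) (G : R -> R) (D : set R) (B : R) :
  right_continuous G -> countable D ->
  (forall a b, ~ D a -> ~ D b -> H_ n b - H_ n a @[n --> \oo] --> G b - G a) ->
  (forall e, 0 < e -> \forall n \near \oo, (total_variationR (H_ n) <= (B + e)%:E)%E) ->
  (total_variationR G <= B%:E)%E.
Proof.
move=> Grc cD HG HB; apply: ge_ereal_sup => _ [[a b] /= ab <-].
apply: ge_ereal_sup => _ [_ [s abs <-] <-]; rewrite lee_fin.
apply/ler_addgt0Pr => e e0.
pose x_ (i : nat) := nth b (a :: s) i.
have aeD : {ae leb, forall h : R, forall i : nat, ~ D (x_ i + h)}.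
  apply: ae_foralln => i.
  have := countable_ae (sub_countable (card_image_le (fun y => y - x_ i) D) cD).
  apply: (@filterS _ _ (ae_filter_ringOfSetsType leb)) => h nDh Dh; apply: nDh.
  by exists (x_ i + h) => //; rewrite addrC addKr.
have shiftB h : (forall i, ~ D (x_ i + h)) ->
    \sum_(0 <= i < size s) `|G (x_ i.+1 + h) - G (x_ i + h)| <= B.
  move=> Dh; apply/ler_addgt0Pr => r r0.
  have cv : \sum_(0 <= i < size s) `|H_ n (x_ i.+1 + h) - H_ n (x_ i + h)| @[n --> \oo] -->
      \sum_(0 <= i < size s) `|G (x_ i.+1 + h) - G (x_ i + h)|.
    by apply: cvg_sumr => i; apply: cvg_norm; exact: HG.
  apply: (cvgr_to_le cv); near=> n.
  have : (total_variationR (H_ n) <= (B + r)%:E)%E by near: n; exact: HB.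
  rewrite -lee_fin; apply: le_trans.
  apply: (@le_trans _ _ (total_variation (a + h) (b + h) (H_ n))); last first.
    by apply: ereal_sup_ubound; exists (a + h, b + h) => //=; rewrite lerD2r.
  apply: ereal_sup_ubound; exists (variation (a + h) (b + h) (H_ n) (map (fun y => y + h) s)).
    apply: variations_variation.
    case: abs => pas /eqP las; split; last first.
      have lE : last (a + h) [seq y + h | y <- s] = last a s + h.
        exact: (last_map (fun y => y + h) s a).
      by rewrite lE las.
    have -> : path <%O (a + h) [seq y + h | y <- s] =
        path (relpre (fun y => y + h) <%O) a s by have := @path_map _ _ (fun y => y + h) <%O a s.
    by apply: sub_path pas => y z /=; rewrite ltrD2r.
  rewrite /variation size_map; congr EFin; apply: eq_big_nat => i /andP[_ is_].
  have shE j : (j < (size s).+1)%N ->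
      nth (b + h) ((a + h) :: [seq y + h | y <- s]) j = x_ j + h.
    by move=> js; rewrite -(nth_map b (b + h) (fun y => y + h))//.
  by rewrite -(shE i.+1)// -(shE i)// ltnW.
have cvsum : \sum_(0 <= i < size s) `|G (x_ i.+1 + h) - G (x_ i + h)|
    @[h --> (0 : R)^'+] --> variation a b G s.
  by apply: cvg_sumr => i; apply: cvg_norm; apply: cvgB; exact: right_continuous_shift.
have : \forall h \near (0 : R)^'+, variation a b G s - e <
    \sum_(0 <= i < size s) `|G (x_ i.+1 + h) - G (x_ i + h)|.
  by apply: (cvgr_gt _ cvsum); rewrite ltrBlDr ltrDl.
move=> [d /= d0 hd]; have [h [h0 hd' Dh]] := ae_exists_itv aeD d0.
rewrite -lerBlDr; apply: ltW; apply: lt_le_trans (shiftB h Dh).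
by apply: hd => //; rewrite /ball/= sub0r normrN gtr0_norm.
Unshelve. all: by end_near. Qed.

End variation_limit.

(** * Real and imaginary parts *)

Section complex_components.
Context {R : realType}.

Lemma normr_Im_le (z : R[i]) : (`|complex.Im z|%:C <= `|z|)%C.
Proof.
have := normc_ge_Re (z * 'i%C); rewrite ReiNIm normrN normrM.
by rewrite [X in _ * X](_ : _ = 1) ?mulr1// normc_def/= expr0n/= add0r expr1n sqrtr1.
Qed.

Lemma cvg_complexP (T : Type) (F : set_system T) (FF : Filter F) (f : T -> R[i]) (z : R[i]) :
  f x @[x --> F] --> z <->
  complex.Re (f x) @[x --> F] --> complex.Re z /\
  complex.Im (f x) @[x --> F] --> complex.Im z.
Proof.
split=> [/cvgrPdist_lt fz|[/cvgrPdist_lt fRe /cvgrPdist_lt fIm]].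
  split; apply/cvgrPdist_lt => e e0.
    have := fz e%:C%C; rewrite ltcR => /(_ e0); apply: filterS => x.
    by rewrite -ltcR; apply: le_lt_trans; rewrite -raddfB; exact: normc_ge_Re.
  have := fz e%:C%C; rewrite ltcR => /(_ e0); apply: filterS => x.
  by rewrite -ltcR; apply: le_lt_trans; rewrite -raddfB; exact: normr_Im_le.
apply/cvgrPdist_lt => -[e e'] e0.
have [e'0 {}e0] : e' = 0 /\ 0 < e.
  by move: e0; rewrite ltcE/= => /andP[/eqP ->].
rewrite e'0; have e20 : 0 < e / 2 by rewrite divr_gt0.
apply: filterS2 (fRe _ e20) (fIm _ e20) => x.
case: (f x) => a b; case: z {fRe fIm} => c d /= ac bd.
rewrite (_ : (e +i* 0)%C = e%:C%C)// normc_def ltcR/=.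
have e0' := ltW e0.
rewrite -[ltRHS]ger0_norm// -sqrtr_sqr ltr_sqrt ?exprn_gt0//.
rewrite -(real_normK (num_real (c - a))) -(real_normK (num_real (d - b))).
have := normr_ge0 (c - a); have := normr_ge0 (d - b); nra.
Qed.

Lemma continuous_fourier_stieltjes (G : R -> R) :
  class_V G -> continuous (fourier_stieltjes G).
Proof.
move=> GV t; apply/cvg_complexP; split; first exact: continuous_cosT.
exact: continuous_sinT.
Qed.

End complex_components.

(** * The continuity theorem *)

Lemma leq_homo_ltn (phi : nat -> nat) : {homo phi : m n / (m < n)%N} ->
  forall n, (n <= phi n)%N.
Proof. by move=> hphi; elim=> // n IH; exact: leq_ltn_trans IH (hphi _ _ (ltnSn n)). Qed.

Lemma cvg_homo_ltn (phi : nat -> nat) : {homo phi : m n / (m < n)%N} ->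
  phi @ \oo --> \oo.
Proof.
move=> hphi A [N _ NA]; exists N => // n /= Nn; apply: NA => /=.
exact: leq_trans Nn (leq_homo_ltn hphi n).
Qed.

Section continuity_theorem.
Context {R : realType}.
Local Notation leb := (@lebesgue_measure R).
Variables (G_ : nat -> R -> R) (B : R) (g : R -> R[i]).
Hypothesis G_V : forall n, class_V (G_ n).
Hypothesis G_limsup : limn_esup (fun n => total_variationR (G_ n)) = B%:E.
Hypothesis g_lim : {ae leb, forall t : R,
  fourier_stieltjes (G_ n) t @[n --> \oo] --> g t}.

Lemma total_variationR_near (e : R) : 0 < e ->
  \forall n \near \oo, (total_variationR (G_ n) <= (B + e)%:E)%E.
Proof.
move=> e0; have : (limn_esup (fun n => total_variationR (G_ n)) < (B + e)%:E)%E.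
  by rewrite G_limsup lte_fin ltrDl.
move=> /ereal_inf_lt[_ [V Voo <-] Ve]; apply: filterS Voo => n Vn.
by apply: le_trans (ltW Ve); apply: ereal_sup_ubound; exists n.
Qed.

Lemma total_variationR_bounded :
  exists M, forall n, fine (total_variationR (G_ n)) <= M.
Proof.
have [N _ hN] := total_variationR_near ltr01.
have tv0 n : 0 <= fine (total_variationR (G_ n)).
  by rewrite fine_ge0// total_variationR_ge0.
have fin n : total_variationR (G_ n) \is a fin_num.
  by rewrite ge0_fin_numE ?total_variationR_ge0//; case: (G_V n).
have B1 n : (N <= n)%N -> fine (total_variationR (G_ n)) <= B + 1.
  by move=> Nn; rewrite -lee_fin fineK//; exact: hN.
have B10 : 0 <= B + 1 := le_trans (tv0 N) (B1 N (leqnn N)).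
exists (B + 1 + \sum_(i < N) fine (total_variationR (G_ i))) => n.
have [Nn|nN] := leqP N n.
  by rewrite (le_trans (B1 n Nn))// lerDl sumr_ge0.
rewrite (bigD1 (Ordinal nN))//= addrCA lerDl addr_ge0// sumr_ge0//.
Qed.

(** The limit g exists off a null Borel set A but is arbitrary on A, where it may
    fail to be Borel; it is replaced by 0 there. *)
Lemma measurable_version (M : R) : (forall n, fine (total_variationR (G_ n)) <= M) ->
  exists C S : R -> R, [/\ measurable_fun setT C, measurable_fun setT S,
    forall t, `|C t| <= M *+ 3, forall t, `|S t| <= M *+ 3 &
    {ae leb, forall t, g t = (C t +i* S t)%C /\
      (cosT (G_ n) t @[n --> \oo] --> C t /\ sinT (G_ n) t @[n --> \oo] --> S t)}].
Proof.
move=> GM; have [A [mA A0 gA]] := g_lim.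
have gcv t : ~ A t -> fourier_stieltjes (G_ n) t @[n --> \oo] --> g t.
  by move=> At; apply: contrapT => ngt; apply: At; exact: gA.
pose I : R -> R := \1_(~` A).
have mI : measurable_fun setT I by apply: measurable_indic; exact: measurableC.
have I1 t : `|I t| <= 1 by rewrite /I indicE; case: (_ \in _); rewrite ?normr1 ?normr0.
have IA t : ~ A t -> I t = 1 by move=> At; rewrite /I indicE mem_set.
have IA0 t : A t -> I t = 0 by move=> At; rewrite /I indicE memNset//=; exact.
have M0 : 0 <= M *+ 3 := le_trans (normr_ge0 _) (le_trans (normr_cosT_le (G_V 0%N) 0)
  (ler_wMn2r 3 (GM 0%N))).
have comp (u : nat -> R -> R) (v : R -> R) : (forall n, measurable_fun setT (u n)) ->
    (forall n t, `|u n t| <= M *+ 3) ->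
    (forall t, ~ A t -> u n t @[n --> \oo] --> v t) ->
    measurable_fun setT (fun t => v t * I t) /\ forall t, `|v t * I t| <= M *+ 3.
  move=> mu uM uv.
  have cv t : u n t * I t @[n --> \oo] --> v t * I t.
    have [At|At] := pselect (A t); last by apply: cvgM; [exact: uv|exact: cvg_cst].
    rewrite IA0// mulr0; under eq_fun do rewrite mulr0; exact: cvg_cst.
  split.
    apply: (@measurable_fun_cvg _ _ _ setT (fun n t => u n t * I t)) => // n.
    exact: measurable_funM.
  move=> t; have cvn : `|u n t * I t| @[n --> \oo] --> `|v t * I t| by apply: cvg_norm; exact: cv.
  apply: (cvgr_to_le cvn); apply: nearW => n.
  by rewrite normrM -[leRHS]mulr1 ler_pM.
have [mC CM] := comp (fun n => cosT (G_ n)) (fun t => complex.Re (g t))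
  (fun n => measurable_cosT (G_V n))
  (fun n t => le_trans (normr_cosT_le (G_V n) t) (ler_wMn2r 3 (GM n)))
  (fun t At => ((cvg_complexP _ _ _).1 (gcv t At)).1).
have [mS SM] := comp (fun n => sinT (G_ n)) (fun t => complex.Im (g t))
  (fun n => measurable_sinT (G_V n))
  (fun n t => le_trans (normr_sinT_le (G_V n) t) (ler_wMn2r 3 (GM n)))
  (fun t At => ((cvg_complexP _ _ _).1 (gcv t At)).2).
exists (fun t => complex.Re (g t) * I t), (fun t => complex.Im (g t) * I t).
split => //; exists A; split => // t; apply: contra_notP => At.
rewrite /= (IA t At) !mulr1; split; first by case: (g t).
by have := gcv t At; move/cvg_complexP.
Qed.

(** This is applied to the identity for existence, and to an arbitrary phi for
    basic convergence. *)
Lemma subsequence_limit (M : R) (C S : R -> R) (phi : nat -> nat) :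
  (forall n, fine (total_variationR (G_ n)) <= M) ->
  measurable_fun setT C -> measurable_fun setT S ->
  (forall t, `|C t| <= M *+ 3) -> (forall t, `|S t| <= M *+ 3) ->
  {ae leb, forall t, g t = (C t +i* S t)%C /\
    (cosT (G_ n) t @[n --> \oo] --> C t /\ sinT (G_ n) t @[n --> \oo] --> S t)} ->
  {homo phi : m n / (m < n)%N} ->
  exists psi : nat -> nat, {homo psi : m n / (m < n)%N} /\
  exists G : R -> R, [/\ class_V G, (total_variationR G <= B%:E)%E,
    {ae leb, forall t, C t = cosT G t /\ S t = sinT G t} &
    exists D : set R, countable D /\ forall x1 x2, ~ D x1 -> ~ D x2 ->
      G_ (phi (psi k)) x2 - G_ (phi (psi k)) x1 @[k --> \oo] --> G x2 - G x1].
Proof.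
move=> GM mC mS CM SM CS_ae phi_incr.
have [psi [psi_incr [G [Grc GNy [D [cD HG]]]]]] :=
  helly_class_V (fun k => G_V (phi k)) (fun k => GM (phi k)).
have sub_oo : (fun k => phi (psi k)) @ \oo --> \oo.
  exact: (cvg_comp _ _ (cvg_homo_ltn psi_incr) (cvg_homo_ltn phi_incr)).
have GB : (total_variationR G <= B%:E)%E.
  apply: (total_variationR_limit Grc cD HG) => e e0.
  exact: (sub_oo _ (total_variationR_near e0)).
have GV : class_V G by split => //; exact: le_lt_trans GB (ltry _).
exists psi; split => //; exists G; split => //; last by exists D.
apply: (transform_limit_ae (fun k => G_V (phi (psi k))) GV (fun k => GM (phi (psi k)))
  mC mS _ _ CM SM cD HG).
  apply: (@filterS _ _ (ae_filter_ringOfSetsType leb) _ _ _ CS_ae) => t [_ [cvC _]].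
  exact: (cvg_comp _ _ sub_oo cvC).
apply: (@filterS _ _ (ae_filter_ringOfSetsType leb) _ _ _ CS_ae) => t [_ [_ cvS]].
exact: (cvg_comp _ _ sub_oo cvS).
Qed.

End continuity_theorem.

Theorem theorem1 (R : realType) (G_ : nat -> R -> R) (B : R) (g : R -> R[i])
    (G_V : forall n, class_V (G_ n))
    (G_limsup : limn_esup (fun n => total_variationR (G_ n)) = B%:E)
    (g_lim : {ae lebesgue_measure, forall t : R,
       fourier_stieltjes (G_ n) t @[n --> \oo] --> g t}) :
  exists G : R -> R,
    [/\ class_V G, (total_variationR G <= B%:E)%E,
        {ae lebesgue_measure, forall t : R, g t = fourier_stieltjes G t} &
        forall t : R, {for t, continuous g} -> g t = fourier_stieltjes G t]
    /\ [/\ forall H : R -> R, class_V H ->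
             {ae lebesgue_measure, forall t : R, g t = fourier_stieltjes H t} ->
             H = G,
           basic_cvg G_ G &
           (fourier_stieltjes (G_ n) 0 @[n --> \oo] --> g 0 ->
            {for 0, continuous g} ->
            lim_pinfty (G_ n) @[n --> \oo] --> lim_pinfty G)].

Proof.
have [M GM] := total_variationR_bounded G_V G_limsup.
have [C [S [mC mS CM SM CS_ae]]] := measurable_version G_V g_lim GM.
have sublim := subsequence_limit G_V G_limsup GM mC mS CM SM CS_ae.
have CS_unique (G H : R -> R) : class_V G -> class_V H ->
    {ae lebesgue_measure, forall t, C t = cosT G t /\ S t = sinT G t} ->
    {ae lebesgue_measure, forall t, C t = cosT H t /\ S t = sinT H t} -> H = G.
  move=> GV HV aeG aeH; apply: class_V_unique => //.
    apply: continuous_ae_eq; [exact: continuous_cosT|exact: continuous_cosT|].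
    apply: (@filterS2 _ _ (ae_filter_ringOfSetsType lebesgue_measure) _ _ _ _ aeG aeH).
    by move=> t [<- _] [<- _].
  apply: continuous_ae_eq; [exact: continuous_sinT|exact: continuous_sinT|].
  apply: (@filterS2 _ _ (ae_filter_ringOfSetsType lebesgue_measure) _ _ _ _ aeG aeH).
  by move=> t [_ <-] [_ <-].
have [psi [_ [G [GV GB aeG _]]]] := sublim id (fun m n mn => mn).
have gG : {ae lebesgue_measure, forall t, g t = fourier_stieltjes G t}.
  apply: (@filterS2 _ _ (ae_filter_ringOfSetsType lebesgue_measure) _ _ _ _ CS_ae aeG).
  by move=> t [-> _] [-> ->].
have g_cont t : {for t, continuous g} -> g t = fourier_stieltjes G t.
  move=> gt; apply: ae_eq_at_continuity gG gt _; first exact: norm_hausdorff.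
  exact: continuous_fourier_stieltjes.
exists G; split; split => //.
- move=> H HV gH; apply: CS_unique => //.
  apply: (@filterS2 _ _ (ae_filter_ringOfSetsType lebesgue_measure) _ _ _ _ CS_ae gH).
  by move=> t [-> _]; rewrite fourier_stieltjesE => -[-> ->].
- move=> phi phi_incr; have [psi' [psi'_incr [G' [G'V _ aeG' [D [cD HG']]]]]] := sublim phi phi_incr.
  exists psi'; split => //; exists D; split => // x1 x2 Dx1 Dx2.
  by rewrite -(CS_unique _ _ GV G'V aeG aeG'); exact: HG'.
- move=> g0_lim g0_cont.
  have limE (H : R -> R) : class_V H -> lim_pinfty H = cosT H 0.
    by move=> HV; apply/cvg_lim => //; exact: cvg_pinfty_cosT0.
  rewrite (limE G GV) (_ : (fun n => lim_pinfty (G_ n)) = fun n => cosT (G_ n) 0).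
    by have := g0_lim; rewrite (g_cont 0 g0_cont) => /cvg_complexP[].
  by apply/funext => n; exact: limE.
Qed.
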